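(* Let $R\subseteq S$ be an extension of rings with the same set of local units. Then there is an exact sequence of groups $$1\longrightarrow \mathrm{Ker}(\mathscr{D})\cap\mathrm{Ker}\big(\widehat{(-)}\big)\longrightarrow \mathrm{Ker}\big(\widehat{(-)}\big)\xrightarrow{\ \mathscr{D}_{/}\ }\mathbf{Inv}_R(S)\xrightarrow{\ \mathscr{D}'\ }\mathscr{P}(S/R)\xrightarrow{\ \mathscr{O}_r\ }\mathbf{Pic}(S),$$ where $\mathscr{D}_{/}$ is the restriction of $\mathscr{D}:\mathbf{Aut}_{S-R}(S)\to\mathbf{Inv}_R(S)$ to $\mathrm{Ker}\big(\widehat{(-)}\big)$ and the second map is the inclusion.
   Context: Rings are associative, not necessarily unital. A set $\mathsf{E}$ of idempotents of a ring $R$ is a set of local units if for every finite subset $\{r_1,\dots,r_n\}\subseteq R$ there is $e\in\mathsf{E}$ with $er_i=r_ie=r_i$ for all $i$. An extension of rings with the same set of local units $\mathsf{E}$ is a ring $S$ with a subring $R\subseteq S$ such that $\mathsf{E}\subseteq R$ is a set of local units for both $R$ and $S$. For $s\in S$, $Unit\{s\}=\{e\in\mathsf{E}\mid es=se=s\}$. A right $R$-module $X$ is unital if $XR=X$; similarly on the left; a bimodule is unital if it is unital on both sides. Unital $S$-(bi)modules are regarded as unital $R$-(bi)modules by restriction. For subsets $W,V\subseteq S$, $WV$ is the set of finite sums $\sum w_iv_i$ with $w_i\in W$, $v_i\in V$. $\mathbf{Inv}_R(S)$ is the group, under $(X,Y)\mapsto XY$ with neutral element $R$, of unital $R$-subbimodules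 $X\subseteq S$ for which there is an $R$-subbimodule $Y\subseteq S$ with $XY=YX=R$. For $A\in\{R,S\}$, $\mathbf{Pic}(A)$ is the group of isomorphism classes $[P]$ of unital $A$-bimodules $P$ for which there is a unital $A$-bimodule $Q$ with $A$-bimodule isomorphisms $Q\otimes_AP\cong A\cong P\otimes_AQ$; the product is $[P][P']=[P\otimes_AP']$, the neutral element is $[A]$. $\mathbf{Aut}_{S-R}(S)$ is the group, under composition, of $(S,R)$-bimodule automorphisms of $S$; $\mathbf{Aut}_{R\text{-rings}}(S)$ is the group, under composition, of ring automorphisms of $S$ acting as the identity on $R$. The homomorphism $\mathscr{D}:\mathbf{Aut}_{S-R}(S)\to\mathbf{Inv}_R(S)$ is $\mathscr{D}(\lambda)=\lambda^{-1}(R)$. The homomorphism $\widehat{(-)}:\mathbf{Aut}_{S-R}(S)\to\mathbf{Aut}_{R\text{-rings}}(S)$ is $\widehat\lambda(s)=\lambda^{-1}(e)\,s\,\lambda(e)$ for any $e\in Unit\{s\}$. The group $\mathscr{P}(S/R)$: consider triples $(P,\phi,X)$ with $P$ a unital $R$-bimodule, $X$ a unital $S$-bimodule, and $\phi:P\to X$ an $R$-bilinear map such that $\bar\phi_r:P\otimes_RS\to X$, $p\otimes s\mapsto\phi(p)s$, and $\bar\phi_l:S\otimes_RP\to X$, $t\otimes q\mapsto t\phi(q)$, are isomorphisms (of $(R,S)$- and $(S,R)$-bimodules respectively). A morphism $(P,\phi,X)\to(P',\phi',X')$ is a pair $(\alpha,\beta)$ with $\alpha:P\to P'$ $R$-bilinear,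 $\beta:X\to X'$ $S$-bilinear and $\beta\phi=\phi'\alpha$. The elements of $\mathscr{P}(S/R)$ are the isomorphism classes of triples with $[P]\in\mathbf{Pic}(R)$ and $[X]\in\mathbf{Pic}(S)$. The product of the classes of $(P,\phi,X)$ and $(Q,\psi,Y)$ is the class of $(P\otimes_RQ,\ \chi,\ X\otimes_SY)$ with $\chi(p\otimes_R q)=\phi(p)\otimes_S\psi(q)$; the neutral element is the class of $(R,\iota,S)$, $\iota$ the inclusion. This is a group. The homomorphism $\mathscr{D}'$ sends $X\in\mathbf{Inv}_R(S)$ to the class of $(X,\subseteq,S)$ (inclusion map), and the homomorphism $\mathscr{O}_r$ sends the class of $(P,\phi,X)$ to $[X]$. *)

(* Defs.v *)
From HB Require Import structures.
From mathcomp Require Import all_boot all_algebra.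
From mathcomp Require Import boolp classical_sets.
From mathcomp Require Import generic_quotient ring_quotient freeg.

Set Implicit Arguments.
Unset Strict Implicit.
Unset Printing Implicit Defensive.

Import GRing.Theory.
Local Open Scope classical_set_scope.
Local Open Scope ring_scope.
Local Open Scope quotient_scope.

(* MathComp's rings are unital, so associative rings without unit are defined *)
(* here. They, and bimodules, are plain records rather than HB structures     *)
(* because one carrier (such as S itself) is a bimodule in several ways.      *)

Record rng := Rng {
  rng_sort :> zmodType;
  rmul : rng_sort -> rng_sort -> rng_sort;
  rmulA : associative rmul;
  rmulDl : left_distributive rmul +%R;
  rmulDr : right_distributive rmul +%R
}.

Notation "x ** y" := (rmul x y) (at level 40, left associativity).

Record bimod (A B : rng) := Bimod {
  bimod_sort :> zmodType;
  lact : A -> bimod_sort -> bimod_sort;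
  ract : bimod_sort -> B -> bimod_sort;
  lactA : forall a b m, lact (a ** b) m = lact a (lact b m);
  lactDl : forall a b m, lact (a + b) m = lact a m + lact b m;
  lactDr : forall a m n, lact a (m + n) = lact a m + lact a n;
  ractA : forall m a b, ract m (a ** b) = ract (ract m a) b;
  ractDl : forall m n b, ract (m + n) b = ract m b + ract n b;
  ractDr : forall m a b, ract m (a + b) = ract m a + ract m b;
  lractA : forall a m b, ract (lact a m) b = lact a (ract m b)
}.

Notation "a *< m" := (lact a m) (at level 40).
Notation "m >* b" := (ract m b) (at level 40, left associativity).

Definition lunital A B (M : bimod A B) := forall m : M,
  exists s : seq (A * M), m = \sum_(p <- s) (p.1 *< p.2).

Definition runital A B (M : bimod A B) := forall m : M,
  exists s : seq (M * B), m = \sum_(p <- s) (p.1 >* p.2).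

Definition unital A B (M : bimod A B) := lunital M /\ runital M.

Definition is_bihom A B (M N : bimod A B) (f : M -> N) :=
  [/\ forall x y, f (x + y) = f x + f y,
      forall a x, f (a *< x) = a *< f x
    & forall x b, f (x >* b) = f x >* b].

Definition is_biiso A B (M N : bimod A B) (f : M -> N) :=
  is_bihom f /\ bijective f.

Definition biiso A B (M N : bimod A B) := exists f : M -> N, is_biiso f.

Definition regular (A : rng) : bimod A A :=
  Bimod (fun a b m => esym (rmulA a b m)) (@rmulDl A) (@rmulDr A)
        (@rmulA A) (@rmulDl A) (@rmulDr A) (fun a m b => esym (rmulA a m b)).

Definition is_addsub (V : zmodType) (X : set V) :=
  X 0 /\ forall x y, X x -> X y -> X (x - y).

Section AdditiveSubgroup.
Variables (V : zmodType) (X : set V) (hX : is_addsub X).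

Lemma addsub_zmod_closed : zmod_closed (mem X).
Proof. by split=> [|x y]; rewrite !in_setE; [exact: hX.1 | exact: hX.2]. Qed.

Definition addsub_zmodClosed : zmodClosed V :=
  HB.pack (fun x : V => x \in X)
    (GRing.isZmodClosed.Build V (fun x => x \in X) addsub_zmod_closed).

Definition sub_zmod : zmodType :=
  HB.pack {x : V | x \in X} (GRing.SubChoice_isSubZmodule.Build
    V (fun x => x \in X) {x : V | x \in X} addsub_zmod_closed).

Definition sub_val (x : sub_zmod) : V := sval x.

Lemma sub_val_inj : injective sub_val.
Proof. exact: val_inj. Qed.

Lemma sub_valP (x : sub_zmod) : X (sub_val x).
Proof. by have := svalP x; rewrite in_setE. Qed.

Lemma sub_valD x y : sub_val (x + y) = sub_val x + sub_val y.
Proof. by []. Qed.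

Definition sub_of x (Xx : X x) : sub_zmod := exist _ x (mem_set Xx).

Lemma sub_ofK x (Xx : X x) : sub_val (sub_of Xx) = x.
Proof. by []. Qed.

End AdditiveSubgroup.

Arguments sub_val {V X hX}.

Record subring (S : rng) := Subring {
  subring_set :> set S;
  subring_addsub : is_addsub subring_set;
  subring_mul : forall x y,
    subring_set x -> subring_set y -> subring_set (x ** y)
}.

Section SubringRng.
Variables (S : rng) (R : subring S).
Let T := sub_zmod (subring_addsub R).

Definition subring_rmul (x y : T) : T :=
  sub_of (subring_addsub R) (subring_mul (sub_valP x) (sub_valP y)).

Lemma subring_rmulA : associative subring_rmul.
Proof. by move=> x y z; apply: sub_val_inj; rewrite !sub_ofK rmulA. Qed.

Lemma subring_rmulDl : left_distributive subring_rmul +%R.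
Proof.
by move=> x y z; apply: sub_val_inj; rewrite sub_valD !sub_ofK sub_valD rmulDl.
Qed.

Lemma subring_rmulDr : right_distributive subring_rmul +%R.
Proof.
by move=> x y z; apply: sub_val_inj; rewrite sub_valD !sub_ofK sub_valD rmulDr.
Qed.

Definition subring_rng : rng :=
  Rng subring_rmulA subring_rmulDl subring_rmulDr.

Definition incl : subring_rng -> S := sub_val.

Lemma inclM (x y : subring_rng) : incl (x ** y) = incl x ** incl y.
Proof. by []. Qed.

Lemma inclD (x y : subring_rng) : incl (x + y) = incl x + incl y.
Proof. by []. Qed.

End SubringRng.

Coercion subring_rng : subring >-> rng.

Section Restriction.
Variables (S : rng) (R : subring S) (B : rng).

Definition resl (M : bimod S B) : bimod R B.
Proof.
refine (@Bimod R B M (fun a m => incl a *< m) (@ract S B M) _ _ _ _ _ _ _).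
- by move=> a b m; rewrite inclM lactA.
- by move=> a b m; rewrite inclD lactDl.
- by move=> a m n; rewrite lactDr.
- exact: ractA.
- exact: ractDl.
- exact: ractDr.
- by move=> a m b; rewrite lractA.
Defined.

Definition resr (M : bimod B S) : bimod B R.
Proof.
refine (@Bimod B R M (@lact B S M) (fun m a => m >* incl a) _ _ _ _ _ _ _).
- exact: lactA.
- exact: lactDl.
- exact: lactDr.
- by move=> m a b; rewrite inclM ractA.
- by move=> m n b; rewrite ractDl.
- by move=> m a b; rewrite inclD ractDr.
- by move=> a m b; rewrite lractA.
Defined.

End Restriction.

Definition is_subbimod A B (M : bimod A B) (X : set M) :=
  [/\ is_addsub X, forall a x, X x -> X (a *< x)
    & forall x b, X x -> X (x >* b)].

Section SubBimodule.
Variables (A B : rng) (M : bimod A B) (X : set M) (hX : is_subbimod X).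

Lemma subbimod_addsub : is_addsub X. Proof. by case: hX. Qed.

Let T := sub_zmod subbimod_addsub.

Lemma subbimod_lactP a (x : T) : X (a *< sub_val x).
Proof. by case: hX => _ h _; apply: h; exact: sub_valP. Qed.

Lemma subbimod_ractP (x : T) b : X (sub_val x >* b).
Proof. by case: hX => _ _ h; apply: h; exact: sub_valP. Qed.

Definition subbimod : bimod A B.
Proof.
refine (@Bimod A B T
  (fun a x => sub_of subbimod_addsub (subbimod_lactP a x))
  (fun x b => sub_of subbimod_addsub (subbimod_ractP x b)) _ _ _ _ _ _ _).
- by move=> a b m; apply: sub_val_inj; exact: lactA.
- by move=> a b m; apply: sub_val_inj; exact: lactDl.
- by move=> a m n; apply: sub_val_inj; exact: lactDr.
- by move=> m a b; apply: sub_val_inj; exact: ractA.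
- by move=> m n b; apply: sub_val_inj; exact: ractDl.
- by move=> m a b; apply: sub_val_inj; exact: ractDr.
- by move=> a m b; apply: sub_val_inj; exact: lractA.
Defined.

Definition subbimod_val : subbimod -> M := sub_val.

End SubBimodule.

Section TensorGroup.
Variables (A B C : rng) (M : bimod A B) (N : bimod B C).

Let F : zmodType := {freeg (M * N)%type / int}.
Let gen (m : M) (n : N) : F := << (m, n) >>.

Inductive tensor_relator : set F :=
| tensor_relDl m m' n :
    tensor_relator (gen (m + m') n - (gen m n + gen m' n))
| tensor_relDr m n n' :
    tensor_relator (gen m (n + n') - (gen m n + gen m n'))
| tensor_relA m b n :
    tensor_relator (gen (m >* b) n - gen m (b *< n)).

Definition tensor_rel : set F := smallest (@is_addsub F) tensor_relator.

Lemma tensor_rel_addsub : is_addsub tensor_rel.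
Proof.
split=> [X [[]]//|x y hx hy X hX].
by case: (hX) => -[_ h] _; apply: h; [exact: hx | exact: hy].
Qed.

Let Q := Quotient.quot (addsub_zmodClosed tensor_rel_addsub).

Definition tensor_zmod : zmodType := Q.

Definition pure (m : M) (n : N) : tensor_zmod := \pi_Q (gen m n).

(* zmodule G is G as a module over the integers. The value on t is computed   *)
(* from a representative of t, so only balanced f are meaningful (tliftE).    *)
Definition tlift (G : zmodType) (f : M -> N -> G) (t : tensor_zmod) : G :=
  fglift (fun p : M * N => f p.1 p.2 : zmodule G) (repr (t : Q)).

Definition balanced (G : zmodType) (f : M -> N -> G) :=
  [/\ forall m m' n, f (m + m') n = f m n + f m' n,
      forall m n n', f m (n + n') = f m n + f m n'
    & forall m b n, f (m >* b) n = f m (b *< n)].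

Section Lift.
Variables (G : zmodType) (f : M -> N -> G) (hf : balanced f).

Let L : F -> zmodule G := fglift (fun p : M * N => f p.1 p.2 : zmodule G).

Let LB x y : L (x - y) = L x - L y. Proof. exact: lift_is_additive. Qed.
Let L0 : L 0 = 0. Proof. by rewrite -(subr0 0) LB subrr. Qed.
Let LD x y : L (x + y) = L x + L y.
Proof. by rewrite -{1}[y]opprK -[- y]sub0r !LB L0 sub0r opprK. Qed.
Let Lgen m n : L (gen m n) = f m n. Proof. by rewrite /L liftU scale1r. Qed.

Lemma tlift_pi x : tlift f (\pi_Q x) = L x.
Proof.
have : tensor_rel (repr (\pi_Q x) - x).
  have : repr (\pi_Q x) - x \in addsub_zmodClosed tensor_rel_addsub.
    by rewrite Quotient.idealrBE reprK.
  by rewrite in_setE.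
move=> /(_ [set z | L z = 0])/= h.
rewrite /tlift -/(L _); apply/eqP; rewrite -subr_eq0 -LB; apply/eqP/h.
split; first split => [|y z /= hy hz]; first exact: L0.
  by rewrite LB hy hz subr0.
case: hf => fDl fDr fA.
by move=> _ [m m' n|m n n'|m b n] /=; rewrite LB ?LD !Lgen ?fDl ?fDr ?fA subrr.
Qed.

Lemma tliftE m n : tlift f (pure m n) = f m n.
Proof. by rewrite tlift_pi Lgen. Qed.

Lemma tliftD x y : tlift f (x + y) = tlift f x + tlift f y.
Proof.
by rewrite -[x](@reprK _ Q) -[y](@reprK _ Q) -raddfD !tlift_pi LD.
Qed.

End Lift.

Lemma pi_tensor_rel x y : tensor_rel (x - y) ->
  \pi_Q x = \pi_Q y.
Proof. by move=> h; apply/eqP; rewrite -Quotient.idealrBE in_setE. Qed.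

Let piD x y : \pi_Q (x + y) = \pi_Q x + \pi_Q y :> tensor_zmod.
Proof. exact: raddfD. Qed.

Lemma pure_balanced : balanced pure.
Proof.
split=> [m m' n|m n n'|m b n]; rewrite /pure -?piD;
  apply: pi_tensor_rel => X [_]; apply.
- exact: tensor_relDl.
- exact: tensor_relDr.
- exact: tensor_relA.
Qed.

Lemma pureDl m m' n : pure (m + m') n = pure m n + pure m' n.
Proof. by case: pure_balanced. Qed.

Lemma pureDr m n n' : pure m (n + n') = pure m n + pure m n'.
Proof. by case: pure_balanced. Qed.

Lemma pureA m b n : pure (m >* b) n = pure m (b *< n).
Proof. by case: pure_balanced. Qed.

Lemma tensor_ext (G : zmodType) (f g : tensor_zmod -> G) :
  (forall x y, f (x + y) = f x + f y) -> (forall x y, g (x + y) = g x + g y) ->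
  (forall m n, f (pure m n) = g (pure m n)) -> f =1 g.
Proof.
have add0 (h : tensor_zmod -> G) : (forall x y, h (x + y) = h x + h y) ->
    h 0 = 0 /\ forall x, h (- x) = - h x.
  move=> hD; have h0 : h 0 = 0.
    by apply: (@addrI _ (h 0)); rewrite -hD !addr0.
  by split=> // x; apply/eqP; rewrite -addr_eq0 -hD addNr h0.
move=> fD gD fg t; have [f0 fN] := add0 f fD; have [g0 gN] := add0 g gD.
rewrite -[t](@reprK _ Q) -(freeg_sumE (repr (t : Q))).
elim: (dom _) => [|[m n] s IH]; first by rewrite big_nil raddf0 f0 g0.
rewrite big_cons raddfD fD gD {}IH; congr (_ + _).
move: (coeff _ _) => k.
have -> : << k *g (m, n) >> = gen m n *~ k :> F.
  by rewrite freegU_mulz intz.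
rewrite raddfMz -/(pure m n).
have fM i : f (pure m n *+ i) = f (pure m n) *+ i.
  by elim: i => [|i IH]; rewrite ?mulr0n // !mulrS fD IH.
have gM i : g (pure m n *+ i) = g (pure m n) *+ i.
  by elim: i => [|i IH]; rewrite ?mulr0n // !mulrS gD IH.
by case: k => i; rewrite ?NegzE ?mulrNz -?pmulrn ?fN ?gN ?fM ?gM fg.
Qed.

End TensorGroup.

Section TensorBimodule.
Variables (A B C : rng) (M : bimod A B) (N : bimod B C).
Let T := tensor_zmod M N.

Definition tensor_lact (a : A) : T -> T := tlift (fun m n => pure (a *< m) n).
Definition tensor_ract (t : T) (c : C) : T :=
  tlift (fun m n => pure m (n >* c)) t.

Lemma tensor_lact_balanced a :
  balanced (fun (m : M) (n : N) => pure (a *< m) n).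
Proof.
by split=> [m m' n|m n n'|m b n]; rewrite ?lactDr ?lractA -?lractA ?pureDl ?pureDr ?pureA.
Qed.

Lemma tensor_ract_balanced c :
  balanced (fun (m : M) (n : N) => pure m (n >* c)).
Proof.
by split=> [m m' n|m n n'|m b n]; rewrite ?ractDl ?pureDl ?pureDr ?pureA ?lractA.
Qed.

Definition tensor_lactE a m n : tensor_lact a (pure m n) = pure (a *< m) n :=
  tliftE (tensor_lact_balanced a) m n.
Definition tensor_ractE m n c : tensor_ract (pure m n) c = pure m (n >* c) :=
  tliftE (tensor_ract_balanced c) m n.
Definition tensor_lactDr a x y :
  tensor_lact a (x + y) = tensor_lact a x + tensor_lact a y :=
  tliftD (tensor_lact_balanced a) x y.
Definition tensor_ractDl x y c :
  tensor_ract (x + y) c = tensor_ract x c + tensor_ract y c :=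
  tliftD (tensor_ract_balanced c) x y.

Definition tensor : bimod A C.
Proof.
refine (@Bimod A C T tensor_lact tensor_ract _ _ _ _ _ _ _).
- move=> a b; apply: tensor_ext => [x y|x y|m n].
  + by rewrite tensor_lactDr.
  + by rewrite !tensor_lactDr.
  + by rewrite !tensor_lactE lactA.
- move=> a b; apply: tensor_ext => [x y|x y|m n].
  + by rewrite tensor_lactDr.
  + by rewrite !tensor_lactDr addrACA.
  + by rewrite !tensor_lactE lactDl pureDl.
- exact: tensor_lactDr.
- move=> t a b; move: t; apply: tensor_ext => [x y|x y|m n].
  + by rewrite tensor_ractDl.
  + by rewrite !tensor_ractDl.
  + by rewrite !tensor_ractE ractA.
- exact: tensor_ractDl.
- move=> t a b; move: t; apply: tensor_ext => [x y|x y|m n].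
  + by rewrite tensor_ractDl.
  + by rewrite !tensor_ractDl addrACA.
  + by rewrite !tensor_ractE ractDr pureDr.
- move=> a t c; move: t; apply: tensor_ext => [x y|x y|m n].
  + by rewrite tensor_lactDr tensor_ractDl.
  + by rewrite tensor_ractDl tensor_lactDr.
  + by rewrite tensor_lactE !tensor_ractE tensor_lactE.
Defined.

End TensorBimodule.

Arguments pure {A B C M N}.

(* The group with underlying set gset inside the ambient type gsort; gmul is  *)
(* relevant on gset only. Elements of Pic and of P(S/R) are isomorphism       *)
(* classes, taken as predicates; the universe of set is too small for them.   *)
Record group_data := GroupData {
  gsort : Type;
  gset : gsort -> Prop;
  gmul : gsort -> gsort -> gsort;
  gone : gsort
}.

Arguments gset : clear implicits.
Arguments gmul : clear implicits.
Arguments gone : clear implicits.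

Definition is_group (G : group_data) :=
  [/\ gset G (gone G),
      forall x y, gset G x -> gset G y -> gset G (gmul G x y),
      forall x y z, gset G x -> gset G y -> gset G z ->
        gmul G x (gmul G y z) = gmul G (gmul G x y) z,
      forall x, gset G x -> gmul G (gone G) x = x /\ gmul G x (gone G) = x
    & forall x, gset G x -> exists2 y, gset G y &
        gmul G x y = gone G /\ gmul G y x = gone G].

Definition is_group_hom (G H : group_data) (f : gsort G -> gsort H) :=
  (forall x, gset G x -> gset H (f x)) /\
  (forall x y, gset G x -> gset G y -> f (gmul G x y) = gmul H (f x) (f y)).

Definition subgroup_data (G : group_data) (A : gsort G -> Prop) : group_data :=
  GroupData (fun x => gset G x /\ A x) (gmul G) (gone G).

Definition Ker (G H : group_data) (f : gsort G -> gsort H) : group_data :=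
  subgroup_data (fun x => f x = gone H).

Definition is_exact (G H K : group_data)
    (f : gsort G -> gsort H) (g : gsort H -> gsort K) :=
  [/\ is_group G, is_group H, is_group K, is_group_hom f & is_group_hom g] /\
  (forall y, (exists2 x, gset G x & f x = y) <-> gset (Ker g) y).

Definition trivial_group : group_data :=
  @GroupData unit (fun _ => True) (fun _ _ => tt) tt.

Definition trivial_hom (G : group_data) : gsort trivial_group -> gsort G :=
  fun _ => gone G.

Definition biclass A B (M : bimod A B) : bimod A B -> Prop := biiso M.

Section Pic.
Variable A : rng.

Definition is_invertible (P : bimod A A) :=
  unital P /\ exists Q : bimod A A,
    [/\ unital Q, biiso (tensor Q P) (regular A)
      & biiso (regular A) (tensor P Q)].

Definition Pic_mul (C D : bimod A A -> Prop) : bimod A A -> Prop := fun Z =>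
  exists P P', [/\ C P, D P' & biiso (tensor P P') Z].

Definition Pic : group_data :=
  GroupData (fun C => exists2 P : bimod A A, is_invertible P & C = biclass P)
    Pic_mul (biclass (regular A)).

End Pic.

Definition is_local_units (A : rng) (E : set A) :=
  (forall e, E e -> e ** e = e) /\
  (forall s : seq A, exists2 e, E e &
     forall r, r \in s -> e ** r = r /\ r ** e = r).

Section Extension.
Variables (S : rng) (R : subring S) (E : set S).

Definition is_extension :=
  [/\ E `<=` R, is_local_units ((@incl S R) @^-1` E) & is_local_units E].

Definition Units (s : S) : set S :=
  [set e | [/\ E e, e ** s = s & s ** e = s]].

Definition mul_set (W V : set S) : set S :=
  [set x | exists s : seq (S * S),
     (forall p, p \in s -> W p.1 /\ V p.2) /\ x = \sum_(p <- s) p.1 ** p.2].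

Definition S_SR : bimod S R := resr R (regular S).
Definition S_RS : bimod R S := resl R (regular S).
Definition S_RR : bimod R R := resl R (resr R (regular S)).

Definition Inv : group_data :=
  @GroupData (set S)
    (fun X => [/\ is_subbimod (X : set S_RR),
                  mul_set R X = X, mul_set X R = X
                & exists Y, [/\ is_subbimod (Y : set S_RR),
                                mul_set X Y = R & mul_set Y X = R]])
    mul_set R.

Definition Aut_SR : group_data :=
  @GroupData (S -> S) (fun lam => is_biiso (lam : S_SR -> S_SR))
    (fun lam mu => lam \o mu) idfun.

Definition Aut_Rrings : group_data :=
  @GroupData (S -> S)
    (fun f => [/\ forall x y, f (x + y) = f x + f y,
                  forall x y, f (x ** y) = f x ** f y,
                  forall r, subring_set R r -> f r = r
                & bijective f])
    (fun f g => f \o g) idfun.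

Definition map_D (lam : gsort Aut_SR) : gsort Inv := lam @^-1` R.

Definition inv_fun (lam : S -> S) (y : S) : S := xget 0 (lam @^-1` [set y]).

(* Some e in Unit{s} is chosen; by hatE the choice is immaterial.             *)
Definition hat (lam : gsort Aut_SR) : gsort Aut_Rrings := fun s =>
  let e := xget 0 (Units s) in inv_fun lam e ** s ** lam e.

Record triple := Triple {
  triple_P : bimod R R;
  triple_X : bimod S S;
  triple_phi : triple_P -> triple_X
}.

Definition phi_r (T : triple) :
    tensor (triple_P T) S_RS -> resl R (triple_X T) :=
  tlift (fun (p : triple_P T) (s : S_RS) => triple_phi p >* (s : S)).

Definition phi_l (T : triple) :
    tensor S_SR (triple_P T) -> resr R (triple_X T) :=
  tlift (fun (t : S_SR) (q : triple_P T) => (t : S) *< triple_phi q).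

Definition is_triple (T : triple) :=
  [/\ unital (triple_P T), unital (triple_X T),
      is_bihom (@triple_phi T : triple_P T -> resl R (resr R (triple_X T))),
      is_biiso (@phi_r T) & is_biiso (@phi_l T)].

Definition is_triple_mor (T U : triple)
    (f : triple_P T -> triple_P U) (g : triple_X T -> triple_X U) :=
  [/\ is_bihom f, is_bihom g & forall p, g (triple_phi p) = triple_phi (f p)].

Definition triple_iso (T U : triple) := exists f g f' g',
  [/\ @is_triple_mor T U f g, @is_triple_mor U T f' g',
      cancel f f' /\ cancel f' f & cancel g g' /\ cancel g' g].

Definition triple_class (T : triple) : triple -> Prop := triple_iso T.

Definition triple_mul (T U : triple) : triple :=
  @Triple (tensor (triple_P T) (triple_P U)) (tensor (triple_X T) (triple_X U))
    (tlift (fun p q => pure (triple_phi p) (triple_phi q))).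

Definition PSR_mul (C D : triple -> Prop) : triple -> Prop := fun Z =>
  exists T U, [/\ C T, D U & triple_iso (triple_mul T U) Z].

Definition PSR : group_data :=
  GroupData
    (fun C => exists2 T : triple,
       [/\ is_triple T, gset (Pic R) (biclass (triple_P T))
         & gset (Pic S) (biclass (triple_X T))]
       & C = triple_class T)
    PSR_mul
    (triple_class (@Triple (regular R) (regular S) (@incl S R))).

(* The class of (X, inclusion, S); the proof h that X is a sub-bimodule is    *)
(* bound in the class, so that the map is defined on all of set S.            *)
Definition map_D' (X : gsort Inv) : gsort PSR := fun Z =>
  exists h : is_subbimod (X : set S_RR),
    triple_class (@Triple (subbimod h) (regular S) (@subbimod_val _ _ _ _ h)) Z.

Definition map_Or (C : gsort PSR) : gsort (Pic S) := fun Y =>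
  exists2 T, C T & biclass (triple_X T) Y.

Lemma hatE (lam : gsort Aut_SR) s e : is_extension -> gset Aut_SR lam ->
  Units s e -> hat lam s = inv_fun lam e ** s ** lam e.
Proof.
move=> [ER _ [_ EU]] [[_ lamL lamR] [g gK Kg]].
have lamM a x : lam (a ** x) = a ** lam x by exact: lamL.
have lamE f t : Units t f -> t ** lam f = lam t.
  by move=> [_ _ tf]; rewrite -[in RHS]tf -lamM.
have invE y : lam (inv_fun lam y) = y.
  by apply: (@xgetPex _ 0 (lam @^-1` [set y])); exists (g y); exact: Kg.
have main f t : Units t f -> forall h, h ** f = f ->
    inv_fun lam f ** t ** lam f = inv_fun lam h ** lam t.
  move=> Utf h hf; have [Ef ft _] := Utf; have Rf := ER f Ef.
  rewrite -rmulA lamE //.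
  have -> : inv_fun lam f = inv_fun lam h ** f.
    apply: (can_inj gK); rewrite invE.
    have -> : lam (inv_fun lam h ** f) = lam (inv_fun lam h) ** f.
      exact: (lamR (inv_fun lam h) (sub_of (subring_addsub R) Rf)).
    by rewrite invE hf.
  by rewrite -rmulA -lamM ft.
move=> Use; have Use' : Units s (xget 0 (Units s)) by apply: xgetPex; exists e.
have [h _ hP] := EU [:: e; xget 0 (Units s)].
have [he _] := hP e (mem_head _ _).
have /hP[he' _] : xget 0 (Units s) \in [:: e; xget 0 (Units s)].
  by rewrite !inE eqxx orbT.
by rewrite /hat (main _ _ Use' h he') (main _ _ Use h he).
Qed.

End Extension.

(* Main.v *)
Require Import Defs.
From mathcomp Require Import all_boot.
From mathcomp Require Import classical_sets.
From mathcomp Require Import ssralg boolp generic_quotient ring_quotient.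

(** Call a Morita context over [A] a pair of bimodules [P], [Q] with surjective
    bilinear pairings [P x Q -> A] and [Q x P -> A] that are associative in both
    ways. Over a ring with local units, a unital bimodule is invertible if and
    only if it is part of a context ([invertibleP]): the pairings of a context
    induce isomorphisms of the tensor products with [A], and conversely two such
    isomorphisms can be made coherent by twisting one of them with an
    automorphism of [P].

    Everything about triples follows from one observation. A triple
    [phi : P -> X] represents an element of [PSR R] exactly when [phi] extends to
    a morphism [(phi, psi)] from a context [(P, Q)] over [R] to a context
    [(X, Y)] over [S], that is, when [phi] and [psi] preserve both pairings
    ([invertible_tripleP]). Such a morphism makes the two maps from
    [P (x) S] and [S (x) P] to [X] bijective ([ctx_triple]), because local units
    are sums of values of the pairings. Conversely, given a triple and contexts
    for [P] and [X], the element [psi q] is determined by its pairings with the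
    image of [phi] ([triple_ctx_mor]). In this description products are tensor
    products of contexts, the inverse of [phi] is [psi], and [phi] is injective.

    An invertible sub-bimodule [X] of [S] with inverse [Y] gives such a morphism
    with values in [S], the pairings being the multiplication ([Inv_linked]). In
    the other direction, let [g] be an isomorphism from the second component of
    an invertible triple to [S]. Then [S] serves as an inverse of that
    component, and the images of [g \o phi] and [psi] in [S] are mutually inverse
    sub-bimodules; so the triple is that of the image of [g \o phi]
    ([linked_image]). This lemma gives the exactness at [PSR R]. Applied to the
    product of the triples of [X] and [Y], where [g] is the multiplication of
    [S], it shows that [map_D'] is multiplicative. Applied to the inclusion of
    [R] and an automorphism of [S], it shows that [map_D] has values in [Inv R]
    and that [map_D'] is trivial on them.

    Finally, the kernel of [hat] consists of the [S]-bilinear automorphisms of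
    [S] ([Ker_hatP]). An isomorphism from the triple of [X] to the triple of [R]
    is such an automorphism carrying [X] onto [R], whence the exactness at
    [Inv R]. *)

Set Implicit Arguments.
Unset Strict Implicit.
Unset Printing Implicit Defensive.

Import GRing.Theory.
Local Open Scope classical_set_scope.
Local Open Scope ring_scope.
Local Open Scope quotient_scope.

Arguments lact : simpl never.
Arguments ract : simpl never.

(** * Additive maps, bimodule isomorphisms and local units *)

Section Additive.
Variables (U V : zmodType) (f : U -> V).
Hypothesis fD : forall x y, f (x + y) = f x + f y.

Lemma add_map0 : f 0 = 0.
Proof. by apply: (@addrI _ (f 0)); rewrite -fD !addr0. Qed.

Lemma add_mapN x : f (- x) = - f x.
Proof. by apply/eqP; rewrite -addr_eq0 -fD addNr add_map0. Qed.

Lemma add_mapB x y : f (x - y) = f x - f y.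
Proof. by rewrite fD add_mapN. Qed.

Lemma add_map_sum I (s : seq I) (F : I -> U) :
  f (\sum_(i <- s) F i) = \sum_(i <- s) f (F i).
Proof. exact: (big_morph f fD add_map0). Qed.

Lemma add_map_bij :
  (forall x, f x = 0 -> x = 0) -> (forall y, exists x, f x = y) -> bijective f.
Proof.
move=> f0 fS; have [g gE] := choice fS; exists g => [x|]; last exact: gE.
by apply/eqP; rewrite -subr_eq0; apply/eqP/f0; rewrite add_mapB gE subrr.
Qed.

End Additive.

Lemma sum_closure (V : zmodType) T (g : T -> V) (I : Type) (s : seq I)
    (F : I -> V) :
  (forall i, exists r : seq T, F i = \sum_(x <- r) g x) ->
  exists r : seq T, \sum_(i <- s) F i = \sum_(x <- r) g x.
Proof.
move=> FP; elim: s => [|i s [r IH]]; first by exists [::]; rewrite !big_nil.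
by have [r' Fi] := FP i; exists (r' ++ r); rewrite big_cons Fi IH big_cat.
Qed.

Section ActionSums.
Variables (A B : rng) (M : bimod A B) (I : Type) (s : seq I).

Lemma lact_sumr a (F : I -> M) :
  a *< (\sum_(i <- s) F i) = \sum_(i <- s) a *< F i.
Proof. by rewrite (add_map_sum (fun x y => lactDr a x y)). Qed.

Lemma lact_suml (F : I -> A) (m : M) :
  (\sum_(i <- s) F i) *< m = \sum_(i <- s) F i *< m.
Proof. by rewrite (add_map_sum (f := fun a => a *< m) (fun x y => lactDl x y m)). Qed.

Lemma ract_suml (F : I -> M) b :
  (\sum_(i <- s) F i) >* b = \sum_(i <- s) F i >* b.
Proof. by rewrite (add_map_sum (f := fun m => m >* b) (fun x y => ractDl x y b)). Qed.

Lemma ract_sumr (m : M) (F : I -> B) :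
  m >* (\sum_(i <- s) F i) = \sum_(i <- s) m >* F i.
Proof. by rewrite (add_map_sum (fun x y => ractDr m x y)). Qed.

Lemma lact0l (m : M) : 0 *< m = 0.
Proof. exact: (add_map0 (f := fun a => a *< m) (fun x y => lactDl x y m)). Qed.

Lemma lact0r a : a *< (0 : M) = 0.
Proof. exact: (add_map0 (fun x y => lactDr a x y)). Qed.

Lemma ract0r (m : M) : m >* 0 = 0.
Proof. exact: (add_map0 (fun x y => ractDr m x y)). Qed.

End ActionSums.

Section Bihom.
Variables A B : rng.
Implicit Types M N K : bimod A B.

Lemma biiso_comp M N K (f : M -> N) (g : N -> K) :
  is_biiso f -> is_biiso g -> is_biiso (g \o f).
Proof.
move=> [[fD fL fR] fb] [[gD gL gR] gb]; split; last exact: bij_comp.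
by split=> *; rewrite /= ?fD ?fL ?fR ?gD ?gL ?gR.
Qed.

Lemma biiso_id M : is_biiso (idfun : M -> M).
Proof. by split=> //; exists idfun. Qed.

Lemma bihom_can M N (f : M -> N) (g : N -> M) :
  is_bihom f -> cancel f g -> cancel g f -> is_biiso g.
Proof.
move=> [fD fL fR] fK gK; split; last by exists f.
by split=> *; apply: (can_inj fK); rewrite ?fD ?fL ?fR !gK.
Qed.

Lemma biiso_inv M N (f : M -> N) : is_biiso f ->
  exists2 g : N -> M, is_biiso g & cancel f g /\ cancel g f.
Proof. by move=> [fh [g fK gK]]; exists g => //; apply: bihom_can fh fK gK. Qed.

Lemma biiso_refl M : biiso M M.
Proof. by exists idfun; exact: biiso_id. Qed.

Lemma biiso_sym M N : biiso M N -> biiso N M.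
Proof. by move=> [f /biiso_inv[g gi _]]; exists g. Qed.

Lemma biiso_trans M N K : biiso M N -> biiso N K -> biiso M K.
Proof. by move=> [f fi] [g gi]; exists (g \o f); apply: biiso_comp. Qed.

Lemma biiso_lunital M N : biiso M N -> lunital M -> lunital N.
Proof.
move=> [f [[fD fL _] [g _ gK]]] uM n; have [s /(congr1 f)] := uM (g n).
rewrite gK (add_map_sum fD) => ->; exists [seq (p.1, f p.2) | p <- s].
by rewrite big_map; apply: eq_bigr => p _; rewrite fL.
Qed.

Lemma biiso_runital M N : biiso M N -> runital M -> runital N.
Proof.
move=> [f [[fD _ fR] [g _ gK]]] uM n; have [s /(congr1 f)] := uM (g n).
rewrite gK (add_map_sum fD) => ->; exists [seq (f p.1, p.2) | p <- s].
by rewrite big_map; apply: eq_bigr => p _; rewrite fR.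
Qed.

Lemma biiso_unital M N : biiso M N -> unital M -> unital N.
Proof. by move=> i [l r]; split; [exact: biiso_lunital l|exact: biiso_runital r]. Qed.

End Bihom.

Definition locally_unital (A : rng) :=
  forall s : seq A, exists e, forall r, r \in s -> e ** r = r /\ r ** e = r.

Section LocalUnits.
Variables (A B : rng).

Lemma lunital_fix (hA : locally_unital A) (M : bimod A B) :
  lunital M -> forall m : M, exists e, e *< m = m.
Proof.
move=> uM m; have [s ->] := uM m; have [e eP] := hA (map fst s).
exists e; rewrite lact_sumr; apply: eq_big_seq => p ps.
by rewrite -lactA (eP p.1 _).1 // map_f.
Qed.

Lemma runital_fix (hB : locally_unital B) (M : bimod A B) :
  runital M -> forall m : M, exists e, m >* e = m.
Proof.
move=> uM m; have [s ->] := uM m; have [e eP] := hB (map snd s).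
exists e; rewrite ract_suml; apply: eq_big_seq => p ps.
by rewrite -ractA (eP p.2 _).2 // map_f.
Qed.

Lemma unital_regular (hA : locally_unital A) : unital (regular A).
Proof.
split=> a; have [e eP] := hA [:: a]; have [ea ae] := eP a (mem_head _ _).
- by exists [:: (e, a)]; rewrite big_seq1.
- by exists [:: (a, e)]; rewrite big_seq1.
Qed.

End LocalUnits.

(** * Tensor products *)

Section TensorElements.
Variables (A B C : rng) (M : bimod A B) (N : bimod B C).
Implicit Type t : tensor M N.

Lemma lact_pure a (m : M) (n : N) :
  a *< (pure m n : tensor M N) = pure (a *< m) n.
Proof. exact: tensor_lactE. Qed.

Lemma ract_pure (m : M) (n : N) c :
  (pure m n : tensor M N) >* c = pure m (n >* c).
Proof. exact: tensor_ractE. Qed.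

Lemma pure0l (n : N) : pure (0 : M) n = 0.
Proof. exact: (add_map0 (f := fun m : M => pure m n) (fun x y => pureDl x y n)). Qed.

Lemma pure0r (m : M) : pure m (0 : N) = 0.
Proof. exact: (add_map0 (f := pure m) (fun x y => pureDr m x y)). Qed.

Lemma pure_suml I (s : seq I) (F : I -> M) (n : N) :
  pure (\sum_(i <- s) F i) n = \sum_(i <- s) pure (F i) n.
Proof.
by rewrite (add_map_sum (f := fun m : M => pure m n) (fun x y => pureDl x y n)).
Qed.

Lemma pure_sumr I (s : seq I) (m : M) (F : I -> N) :
  pure m (\sum_(i <- s) F i) = \sum_(i <- s) pure m (F i).
Proof. by rewrite (add_map_sum (f := pure m) (fun x y => pureDr m x y)). Qed.

(** [tensor_ext] only compares additive maps; comparing the projection onto the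
    quotient by the subgroup [D] with the zero map turns it into a membership
    criterion. *)
Lemma tensor_addsub (D : set (tensor M N)) :
  is_addsub D -> (forall m n, D (pure m n)) -> forall t, D t.
Proof.
move=> hD Dpure t.
pose Q := Quotient.quot (addsub_zmodClosed hD).
have pi_eq0 x : (\pi_Q x = 0 :> Q) <-> D x.
  rewrite -(raddf0 \pi_Q) -[X in D X]subr0; split=> [/eqP|Dx].
    by rewrite -Quotient.idealrBE in_setE.
  by apply/eqP; rewrite -Quotient.idealrBE in_setE.
apply/pi_eq0; move: t; apply: tensor_ext => [x y|x y|m n].
- by rewrite raddfD.
- by rewrite addr0.
- exact/pi_eq0.
Qed.

Lemma tensor_sum t : exists s : seq (M * N), t = \sum_(p <- s) pure p.1 p.2.
Proof.
pose D : set (tensor M N) :=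
  [set t | exists s : seq (M * N), t = \sum_(p <- s) pure p.1 p.2].
apply: (@tensor_addsub D).
  split=> [|_ _ [s ->] [r ->]]; first by exists [::]; rewrite big_nil.
  exists (s ++ [seq (- p.1, p.2) | p <- r]); rewrite big_cat big_map /= -sumrN.
  congr (_ + _); apply: eq_bigr => p _.
  by rewrite (add_mapN (f := fun m => pure m p.2) (fun x y => pureDl x y p.2)).
by move=> m n; exists [:: (m, n)]; rewrite big_seq1.
Qed.

Lemma tensor_ind (D : tensor M N -> Prop) : (forall m n, D (pure m n)) ->
  (forall x y, D x -> D y -> D (x + y)) -> forall t, D t.
Proof.
move=> Dp DD t; have [s ->] := tensor_sum t.
elim: s => [|p s IH]; first by rewrite big_nil -(pure0l 0).
by rewrite big_cons; apply: DD.
Qed.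

End TensorElements.

Lemma tensor_ind2 A B C A' B' C' (M : bimod A B) (N : bimod B C)
    (M' : bimod A' B') (N' : bimod B' C')
    (Pr : tensor M N -> tensor M' N' -> Prop) :
  (forall m n m' n', Pr (pure m n) (pure m' n')) ->
  (forall x y u, Pr x u -> Pr y u -> Pr (x + y) u) ->
  (forall x u v, Pr x u -> Pr x v -> Pr x (u + v)) -> forall t u, Pr t u.
Proof.
move=> Pp PDl PDr; apply: tensor_ind => [m n|x y ex ey] u; last exact: PDl.
by move: u; apply: tensor_ind => [m' n'|x y ex ey]; [exact: Pp|exact: PDr].
Qed.

Section TensorUnital.
Variables (A B C : rng) (M : bimod A B) (N : bimod B C).

Lemma lunital_tensor : lunital M -> lunital (tensor M N).
Proof.
move=> uM; apply: tensor_ind => [m n|_ _ [s ->] [r ->]]; last first.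
  by exists (s ++ r); rewrite big_cat.
have [s ->] := uM m; exists [seq (p.1, pure p.2 n) | p <- s].
rewrite pure_suml big_map; apply: eq_bigr => p _.
by rewrite lact_pure.
Qed.

Lemma runital_tensor : runital N -> runital (tensor M N).
Proof.
move=> uN; apply: tensor_ind => [m n|_ _ [s ->] [r ->]]; last first.
  by exists (s ++ r); rewrite big_cat.
have [s ->] := uN n; exists [seq (pure m p.1, p.2) | p <- s].
rewrite pure_sumr big_map; apply: eq_bigr => p _.
by rewrite ract_pure.
Qed.

Lemma tlift_bihom (K : bimod A C) (f : M -> N -> K) : balanced f ->
  (forall a m n, f (a *< m) n = a *< f m n) ->
  (forall m n c, f m (n >* c) = f m n >* c) ->
  is_bihom (tlift f : tensor M N -> K).
Proof.
move=> fb fl fr; split=> [x y|a|t c]; first exact: tliftD.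
- apply: tensor_ind => [m n|x y ex ey].
    by rewrite lact_pure !tliftE.
  by rewrite lactDr !(tliftD fb) lactDr ex ey.
- move: t; apply: tensor_ind => [m n|x y ex ey].
    by rewrite ract_pure !tliftE.
  by rewrite ractDl !(tliftD fb) ractDl ex ey.
Qed.

End TensorUnital.

Lemma unital_tensor A B C (M : bimod A B) (N : bimod B C) :
  unital M -> unital N -> unital (tensor M N).
Proof. by move=> [uM _] [_ uN]; split; [exact: lunital_tensor|exact: runital_tensor]. Qed.

Section TensorMap.
Variables (A B C : rng).
Implicit Types (M : bimod A B) (N : bimod B C).

Definition tmap M M' N N' (f : M -> M') (g : N -> N') :
    tensor M N -> tensor M' N' := tlift (fun m n => pure (f m) (g n)).

Lemma tmap_balanced M M' N N' (f : M -> M') (g : N -> N') :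
  is_bihom f -> is_bihom g -> balanced (fun m n => pure (f m) (g n)).
Proof.
move=> [fD _ fR] [gD gL _].
by split=> *; rewrite ?fD ?gD ?fR ?gL ?pureDl ?pureDr ?pureA.
Qed.

Lemma tmapE M M' N N' (f : M -> M') (g : N -> N') m n :
  is_bihom f -> is_bihom g -> tmap f g (pure m n) = pure (f m) (g n).
Proof. by move=> fh gh; exact: tliftE (tmap_balanced fh gh) _ _. Qed.

Lemma tmap_bihom M M' N N' (f : M -> M') (g : N -> N') :
  is_bihom f -> is_bihom g -> is_bihom (tmap f g).
Proof.
move=> fh gh; apply: tlift_bihom; first exact: tmap_balanced.
- by case: fh => _ fL _ a m n; rewrite fL lact_pure.
- by case: gh => _ _ gR m n c; rewrite gR ract_pure.
Qed.

Lemma tmap_biiso M M' N N' (f : M -> M') (g : N -> N') :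
  is_biiso f -> is_biiso g -> is_biiso (tmap f g).
Proof.
move=> fi gi; have [f' [fh' _] [fK fK']] := biiso_inv fi.
have [g' [gh' _] [gK gK']] := biiso_inv gi.
case: fi gi => fh _ [gh _]; have Th := tmap_bihom fh gh.
have Th' := tmap_bihom fh' gh'; split=> //; exists (tmap f' g').
- move: Th Th' => [TD _ _] [TD' _ _]; apply: tensor_ind => [m n|x y ex ey].
    by rewrite !tmapE // fK gK.
  by rewrite TD TD' ex ey.
- move: Th Th' => [TD _ _] [TD' _ _]; apply: tensor_ind => [m n|x y ex ey].
    by rewrite !tmapE // fK' gK'.
  by rewrite TD' TD ex ey.
Qed.

Lemma biiso_tensor M M' N N' :
  biiso M M' -> biiso N N' -> biiso (tensor M N) (tensor M' N').
Proof. by move=> [f fi] [g gi]; exists (tmap f g); exact: tmap_biiso. Qed.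

End TensorMap.

Section TensorAssoc.
Variables (A B C D : rng) (M : bimod A B) (N : bimod B C) (K : bimod C D).

Definition tassoc : tensor (tensor M N) K -> tensor M (tensor N K) :=
  tlift (fun (u : tensor M N) (k : K) =>
    tlift (fun m n => pure m (pure n k : tensor N K)) u).

Definition tassocV : tensor M (tensor N K) -> tensor (tensor M N) K :=
  tlift (fun (m : M) (v : tensor N K) =>
    tlift (fun n k => pure (pure m n : tensor M N) k) v).

Let inner k : balanced (fun (m : M) (n : N) => pure m (pure n k : tensor N K)).
Proof.
by split=> *; rewrite ?pureDl ?pureDr // pureA; congr pure; rewrite lact_pure.
Qed.

Let innerV m : balanced (fun (n : N) (k : K) => pure (pure m n : tensor M N) k).
Proof.
split=> [n n' k|n k k'|n c k]; rewrite ?pureDr ?pureDl //.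
by rewrite -pureA; congr pure; rewrite ract_pure.
Qed.

Let outer : balanced (fun (u : tensor M N) k =>
  tlift (fun m n => pure m (pure n k : tensor N K)) u).
Proof.
split=> [u u' k|u k k'|u c k]; first by rewrite tliftD.
- move: u; apply: tensor_ind => [m n|x y ex ey]; first by rewrite !tliftE // !pureDr.
  by rewrite !(tliftD (inner _)) ex ey addrACA.
- move: u; apply: tensor_ind => [m n|x y ex ey]; last first.
    by rewrite ractDl !(tliftD (inner _)) ex ey.
  by rewrite ract_pure !tliftE // pureA.
Qed.

Let outerV : balanced (fun m (v : tensor N K) =>
  tlift (fun n k => pure (pure m n : tensor M N) k) v).
Proof.
split=> [m m' v|m v v'|m b v]; last 1 first.
- move: v; apply: tensor_ind => [n k|x y ex ey]; last first.
    by rewrite lactDr !(tliftD (innerV _)) ex ey.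
  by rewrite lact_pure !tliftE // pureA.
- move: v; apply: tensor_ind => [n k|x y ex ey]; first by rewrite !tliftE // !pureDl.
  by rewrite !(tliftD (innerV _)) ex ey addrACA.
- by rewrite tliftD.
Qed.

Lemma tassocE m n k :
  tassoc (pure (pure m n : tensor M N) k) = pure m (pure n k : tensor N K).
Proof. by rewrite /tassoc tliftE // tliftE. Qed.

Lemma tassocVE m n k :
  tassocV (pure m (pure n k : tensor N K)) = pure (pure m n : tensor M N) k.
Proof. by rewrite /tassocV tliftE // tliftE. Qed.

Lemma tassocD x y : tassoc (x + y) = tassoc x + tassoc y.
Proof. exact: tliftD. Qed.

Lemma tassocVD x y : tassocV (x + y) = tassocV x + tassocV y.
Proof. exact: tliftD. Qed.

Lemma tensor_ind3 (Pr : tensor (tensor M N) K -> Prop) :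
  (forall m n k, Pr (pure (pure m n : tensor M N) k)) ->
  (forall x y, Pr x -> Pr y -> Pr (x + y)) -> forall t, Pr t.
Proof.
move=> Pp PD; apply: tensor_ind => // u k; move: u.
by apply: tensor_ind => // x y ex ey; rewrite pureDl; apply: PD.
Qed.

Lemma tensor_ind3r (Pr : tensor M (tensor N K) -> Prop) :
  (forall m n k, Pr (pure m (pure n k : tensor N K))) ->
  (forall x y, Pr x -> Pr y -> Pr (x + y)) -> forall t, Pr t.
Proof.
move=> Pp PD; apply: tensor_ind => // m; apply: tensor_ind => // x y ex ey.
by rewrite pureDr; apply: PD.
Qed.

Lemma tassoc_biiso : is_biiso tassoc.
Proof.
split; last exists tassocV.
- split=> [x y|a|t d]; first exact: tassocD.
  + apply: tensor_ind3 => [m n k|x y ex ey].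
      by rewrite !(tassocE, lact_pure).
    by rewrite lactDr !tassocD lactDr ex ey.
  + move: t; apply: tensor_ind3 => [m n k|x y ex ey].
      by rewrite !(tassocE, ract_pure).
    by rewrite ractDl !tassocD ractDl ex ey.
- apply: tensor_ind3 => [m n k|x y ex ey]; first by rewrite tassocE tassocVE.
  by rewrite tassocD tassocVD ex ey.
- apply: tensor_ind3r => [m n k|x y ex ey]; first by rewrite tassocVE tassocE.
  by rewrite tassocVD tassocD ex ey.
Qed.

End TensorAssoc.

Section TensorUnits.
Variables (A B : rng) (M : bimod A B).

Definition lunit : tensor (regular A) M -> M :=
  tlift (fun (a : regular A) (m : M) => (a : A) *< m).
Definition runit : tensor M (regular B) -> M :=
  tlift (fun (m : M) (b : regular B) => m >* (b : B)).

Let lb : balanced (fun (a : regular A) (m : M) => (a : A) *< m).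
Proof. by split=> *; rewrite ?lactDl ?lactDr ?lactA. Qed.

Let rb : balanced (fun (m : M) (b : regular B) => m >* (b : B)).
Proof. by split=> *; rewrite ?ractDl ?ractDr ?ractA. Qed.

Lemma lunitE a m : lunit (pure (a : regular A) m) = a *< m. Proof. exact: tliftE. Qed.
Lemma runitE m b : runit (pure m (b : regular B)) = m >* b. Proof. exact: tliftE. Qed.

(** Injectivity holds because a left unit [e] of [t] gives
    [t = e t = pure e (lunit t)]: scalars move across the tensor sign. *)
Lemma lunit_biiso : locally_unital A -> lunital M -> is_biiso lunit.
Proof.
move=> hA uM; have lD := tliftD lb; split.
  by apply: tlift_bihom => // *; rewrite ?lactA ?lractA.
apply: (add_map_bij lD) => [t|m]; last first.
  have [s ->] := uM m; exists (\sum_(p <- s) pure (p.1 : regular A) p.2).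
  by rewrite (add_map_sum lD); apply: eq_bigr => p _; exact: lunitE.
have [e te] := lunital_fix hA (lunital_tensor (N := M) (unital_regular hA).1) t.
have tE : t = pure (e : regular A) (lunit t).
  rewrite -[LHS]te; move: (t); apply: tensor_ind => [a m|x y ex ey].
    by rewrite lact_pure lunitE -pureA.
  by rewrite lactDr ex ey -pureDr -lD.
by move=> t0; rewrite tE (t0 : lunit t = 0) pure0r.
Qed.

Lemma runit_biiso : locally_unital B -> runital M -> is_biiso runit.
Proof.
move=> hB uM; have rD := tliftD rb; split.
  by apply: tlift_bihom => // *; rewrite ?ractA ?lractA.
apply: (add_map_bij rD) => [t|m]; last first.
  have [s ->] := uM m; exists (\sum_(p <- s) pure p.1 (p.2 : regular B)).
  by rewrite (add_map_sum rD); apply: eq_bigr => p _; exact: runitE.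
have [e te] := runital_fix hB (runital_tensor (M := M) (unital_regular hB).2) t.
have tE : t = pure (runit t) (e : regular B).
  rewrite -[LHS]te; move: (t); apply: tensor_ind => [m b|x y ex ey].
    by rewrite ract_pure runitE pureA.
  by rewrite ractDl ex ey -pureDl -rD.
by move=> t0; rewrite tE (t0 : runit t = 0) pure0l.
Qed.

End TensorUnits.

(** * Morita contexts *)

(** Equivalently, [f] induces a surjective bimodule map from [tensor P Q] to
    [regular A]. *)
Definition is_pairing A (P Q : bimod A A) (f : P -> Q -> A) :=
  [/\ balanced f,
      forall a p q, f (a *< p) q = a ** f p q,
      forall p q a, f p (q >* a) = f p q ** a
    & forall a, exists s : seq (P * Q), a = \sum_(x <- s) f x.1 x.2].

(** A Morita context between [A] and itself, with both pairings surjective. *)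
Record context A (P Q : bimod A A) := Context {
  cpq : P -> Q -> A;
  cqp : Q -> P -> A;
  cpq_pairing : is_pairing cpq;
  cqp_pairing : is_pairing cqp;
  cpqA : forall p q p', cpq p q *< p' = p >* cqp q p';
  cqpA : forall q p q', cqp q p *< q' = q >* cpq p q'
}.

Definition ctx_sym A (P Q : bimod A A) (c : context P Q) : context Q P :=
  Context (cqp_pairing c) (cpq_pairing c) (cqpA c) (cpqA c).

Section ContextTheory.
Variables (A : rng) (P Q : bimod A A) (c : context P Q).

Lemma cpqDl p p' q : cpq c (p + p') q = cpq c p q + cpq c p' q.
Proof. by have [[]] := cpq_pairing c. Qed.

Lemma cpqDr p q q' : cpq c p (q + q') = cpq c p q + cpq c p q'.
Proof. by have [[]] := cpq_pairing c. Qed.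

Lemma cpqM p a q : cpq c (p >* a) q = cpq c p (a *< q).
Proof. by have [[]] := cpq_pairing c. Qed.

Lemma cpqL a p q : cpq c (a *< p) q = a ** cpq c p q.
Proof. by have [] := cpq_pairing c. Qed.

Lemma cpqR p q a : cpq c p (q >* a) = cpq c p q ** a.
Proof. by have [] := cpq_pairing c. Qed.

Lemma cpq_onto a : exists s : seq (P * Q), a = \sum_(x <- s) cpq c x.1 x.2.
Proof. by have [] := cpq_pairing c. Qed.

Lemma cpq0l q : cpq c 0 q = 0.
Proof. exact: (add_map0 (f := fun p => cpq c p q) (fun x y => cpqDl x y q)). Qed.

Lemma cpq0r p : cpq c p 0 = 0.
Proof. exact: (add_map0 (cpqDr p)). Qed.

Lemma cpq_suml I (s : seq I) F q :
  cpq c (\sum_(i <- s) F i) q = \sum_(i <- s) cpq c (F i) q.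
Proof. by rewrite (add_map_sum (f := fun p => cpq c p q) (fun x y => cpqDl x y q)). Qed.

Lemma cpq_sumr I (s : seq I) p F :
  cpq c p (\sum_(i <- s) F i) = \sum_(i <- s) cpq c p (F i).
Proof. by rewrite (add_map_sum (cpqDr p)). Qed.

(** A unit for [p] is a sum of values of [cpq c], and [cpqA] turns the action of
    such a value on [p] into the action of a value [cqp c q p]. *)
Lemma cqp_nondeg : locally_unital A -> lunital P ->
  forall p, (forall q, cqp c q p = 0) -> p = 0.
Proof.
move=> hA uP p p0; have [e <-] := lunital_fix hA uP p; have [s ->] := cpq_onto e.
rewrite lact_suml big1 // => x _.
by rewrite cpqA p0 ract0r.
Qed.

End ContextTheory.

Section ContextSym.
Variables (A : rng) (P Q : bimod A A) (c : context P Q).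

Definition cqpDl q q' p : cqp c (q + q') p = cqp c q p + cqp c q' p :=
  cpqDl (ctx_sym c) q q' p.
Definition cqpDr q p p' : cqp c q (p + p') = cqp c q p + cqp c q p' :=
  cpqDr (ctx_sym c) q p p'.
Definition cqpM q a p : cqp c (q >* a) p = cqp c q (a *< p) :=
  cpqM (ctx_sym c) q a p.
Definition cqpL a q p : cqp c (a *< q) p = a ** cqp c q p :=
  cpqL (ctx_sym c) a q p.
Definition cqpR q p a : cqp c q (p >* a) = cqp c q p ** a :=
  cpqR (ctx_sym c) q p a.
Definition cqp_onto a : exists s : seq (Q * P), a = \sum_(x <- s) cqp c x.1 x.2 :=
  cpq_onto (ctx_sym c) a.
Definition cqp0r q : cqp c q 0 = 0 := cpq0r (ctx_sym c) q.

End ContextSym.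

Section ContextExamples.
Variable A : rng.
Implicit Types P Q : bimod A A.

Lemma pairing_of_biiso P Q (F : tensor P Q -> regular A) :
  is_biiso F -> is_pairing (fun p q => F (pure p q)).
Proof.
move=> [[FD FL FR] [G FK GK]]; split=> [|a p q|p q a|a].
- by split=> *; rewrite ?pureDl ?pureDr ?pureA ?FD.
- by rewrite -lact_pure FL.
- by rewrite -ract_pure FR.
- have [s Ga] := tensor_sum (G a); exists s.
  by rewrite -[LHS]GK Ga (add_map_sum FD).
Qed.

(** The surjection induced by a pairing is injective: for a right unit
    [e = \sum_i cpq c p_i q_i] of [t], the two associativity laws give
    [t = \sum_i (tlift (cpq c) t *< pure p_i q_i)]. *)
Lemma ctx_biiso P Q (c : context P Q) : locally_unital A -> runital Q ->
  is_biiso (tlift (cpq c) : tensor P Q -> regular A).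
Proof.
move=> hA uQ; have cb : balanced (cpq c) by have [] := cpq_pairing c.
have cD := tliftD cb; split.
  apply: tlift_bihom => // [a p q|p q a]; [exact: cpqL|exact: cpqR].
apply: (add_map_bij cD) => [t|a]; last first.
  have [s ->] := cpq_onto c a; exists (\sum_(x <- s) pure x.1 x.2).
  by rewrite (add_map_sum cD); apply: eq_bigr => x _; rewrite tliftE.
have [e te] := runital_fix hA (runital_tensor (M := P) uQ) t.
have [s es] := cpq_onto c e.
have tE : t = \sum_(x <- s) (tlift (cpq c) t *< (pure x.1 x.2 : tensor P Q)).
  rewrite -[LHS]te {}es; move: (t); apply: tensor_ind => [p q|x y ex ey].
    rewrite ract_sumr; apply: eq_bigr => x _.
    by rewrite tliftE // lact_pure ract_pure -cqpA -pureA cpqA.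
  rewrite ractDl ex ey -big_split; apply: eq_bigr => i _ /=.
  by rewrite cD lactDl.
by move=> t0; rewrite tE t0 big1 // => x _; rewrite lact0l.
Qed.

Lemma mul_pairing : locally_unital A ->
  is_pairing (fun a b : A => a ** b : A) (P := regular A) (Q := regular A).
Proof.
move=> hA; split=> [|a p q|p q a|a]; rewrite ?rmulA //.
  by split=> *; rewrite ?rmulDl ?rmulDr -?rmulA.
have [e eP] := hA [:: a]; exists [:: (e, a)].
by rewrite big_seq1; have [] := eP a (mem_head _ _).
Qed.

Definition ctx_regular (hA : locally_unital A) :
    context (regular A) (regular A) :=
  Context (mul_pairing hA) (mul_pairing hA)
    (fun p q p' => esym (rmulA p q p')) (fun p q p' => esym (rmulA p q p')).

(** In particular [regular A] can serve as the second bimodule for every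
    bimodule isomorphic to [regular A]. *)
Lemma ctx_transport P P' Q (g : P' -> P) (c : context P Q) : is_biiso g ->
  exists c' : context P' Q,
    (forall p q, cpq c' p q = cpq c (g p) q) /\
    (forall q p, cqp c' q p = cqp c q (g p)).
Proof.
move=> gi; have [g' [[hD hL hR] _] [gK gK']] := biiso_inv gi.
case: gi => -[gD gL gR] _.
have pq : is_pairing (fun p q => cpq c (g p) q).
  split=> [|a p q|p q a|a].
  - by split=> *; rewrite ?gD ?gR ?cpqDl ?cpqDr ?cpqM.
  - by rewrite gL cpqL.
  - by rewrite cpqR.
  - have [s ->] := cpq_onto c a; exists [seq (g' x.1, x.2) | x <- s].
    by rewrite big_map; apply: eq_bigr => x _ /=; rewrite gK'.
have qp : is_pairing (fun q p => cqp c q (g p)).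
  split=> [|a p q|p q a|a].
  - by split=> *; rewrite ?gD ?gL ?cqpDl ?cqpDr ?cqpM.
  - exact: cqpL.
  - by rewrite gR; exact: cqpR.
  - have [s ->] := cqp_onto c a; exists [seq (x.1, g' x.2) | x <- s].
    by rewrite big_map; apply: eq_bigr => x _ /=; rewrite gK'.
have pA p q p' : cpq c (g p) q *< p' = p >* cqp c q (g p').
  by apply: (can_inj gK); rewrite gL gR cpqA.
have qA q p q' : cqp c q (g p) *< q' = q >* cpq c (g p) q' by rewrite cqpA.
by exists (Context pq qp pA qA).
Qed.

End ContextExamples.

Section ContextTensor.
Variable A : rng.

(** On pure tensors this is [cpq c p (cpq c' p' q' *< q)]. The factors of the
    second tensor product come in the opposite order, as in the inverse of a
    product. *)
Definition tpair P Q P' Q' (c : @context A P Q) (c' : @context A P' Q')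
    (t : tensor P P') (u : tensor Q' Q) : A :=
  tlift (fun p p' => tlift (fun q' q => cpq c p (cpq c' p' q' *< q)) u) t.

Section Pairing.
Variables (P Q P' Q' : bimod A A) (c : context P Q) (c' : context P' Q').

Let inner p p' : balanced (fun q' q => cpq c p (cpq c' p' q' *< q)).
Proof.
split=> [q1 q2 q|q' q1 q2|q' a q].
- by rewrite cpqDr lactDl cpqDr.
- by rewrite lactDr cpqDr.
- by rewrite cpqR lactA.
Qed.

Let outer u :
  balanced (fun p p' => tlift (fun q' q => cpq c p (cpq c' p' q' *< q)) u).
Proof.
split=> [p1 p2 p'|p p1 p2|p a p']; move: u; apply: tensor_ind => [q' q|x y ex ey];
  rewrite ?tliftE // ?(tliftD (inner _ _)) ?ex ?ey //; try by rewrite addrACA.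
- exact: cpqDl.
- by rewrite cpqDl lactDl cpqDr.
- by rewrite cpqM cpqL lactA.
Qed.

Lemma tpairE p p' q' q :
  tpair c c' (pure p p') (pure q' q) = cpq c p (cpq c' p' q' *< q).
Proof. by rewrite /tpair !tliftE. Qed.

Lemma tpairDl t t' u : tpair c c' (t + t') u = tpair c c' t u + tpair c c' t' u.
Proof. by rewrite /tpair tliftD. Qed.

Lemma tpairDr t u u' : tpair c c' t (u + u') = tpair c c' t u + tpair c c' t u'.
Proof.
move: t; apply: tensor_ind => [p p'|x y ex ey].
  by rewrite /tpair !(tliftE (outer _)) (tliftD (inner _ _)).
by rewrite !tpairDl ex ey addrACA.
Qed.

Lemma tpair_pairing : locally_unital A -> lunital Q -> is_pairing (tpair c c').
Proof.
move=> hA uQ; split=> [|a|t u a|a].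
- split=> [t t' u|t u u'|t a u]; [exact: tpairDl|exact: tpairDr|].
  move: t u; apply: tensor_ind2 => [p p' q' q|x y u ex ey|x u v ex ey].
  + by rewrite ract_pure lact_pure !tpairE cpqM.
  + by rewrite ractDl !tpairDl ex ey.
  + by rewrite lactDr !tpairDr ex ey.
- apply: tensor_ind2 => [p p' q' q|x y u ex ey|x u v ex ey].
  + by rewrite lact_pure !tpairE cpqL.
  + by rewrite lactDr !tpairDl rmulDr ex ey.
  + by rewrite !tpairDr rmulDr ex ey.
- move: t u; apply: tensor_ind2 => [p p' q' q|x y u ex ey|x u v ex ey].
  + by rewrite ract_pure !tpairE -lractA cpqR.
  + by rewrite !tpairDl rmulDl ex ey.
  + by rewrite ractDl !tpairDr rmulDl ex ey.
- have [s ->] := cpq_onto c a.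
  apply: (sum_closure (g := fun x => tpair c c' x.1 x.2)) => x.
  have [e qe] := lunital_fix hA uQ x.2; have [r er] := cpq_onto c' e.
  exists [seq (pure x.1 y.1, pure y.2 x.2) | y <- r].
  rewrite big_map -[in LHS]qe er lact_suml cpq_sumr.
  by apply: eq_bigr => y _; rewrite tpairE.
Qed.

End Pairing.

Lemma tpairA P Q P' Q' (c : context P Q) (c' : context P' Q') t u t' :
  tpair c c' t u *< t' = t >* tpair (ctx_sym c') (ctx_sym c) u t'.
Proof.
move: t u; apply: tensor_ind2 => [p p' q' q|x y u ex ey|x u v ex ey].
- move: t'; apply: tensor_ind => [p1 p1'|x y ex ey]; last first.
    by rewrite tpairDr lactDr ractDr ex ey.
  rewrite !tpairE lact_pure ract_pure cpqA pureA cqpL.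
  by rewrite lactA cpqA.
- by rewrite tpairDl lactDl ractDl ex ey.
- by rewrite tpairDr tpairDl lactDl ractDr ex ey.
Qed.

Definition ctx_tensor P Q P' Q' (hA : locally_unital A) (uQ : lunital Q)
    (uP' : lunital P') (c : context P Q) (c' : context P' Q') :
    context (tensor P P') (tensor Q' Q) :=
  Context (tpair_pairing c c' hA uQ)
    (tpair_pairing (ctx_sym c') (ctx_sym c) hA uP')
    (tpairA c c') (tpairA (ctx_sym c') (ctx_sym c)).

End ContextTensor.

(** * Invertible bimodules and their classes *)

Section Invertible.
Variables (A : rng) (hA : locally_unital A).
Implicit Types P Q : bimod A A.

Lemma invertible_of_context P Q :
  unital P -> unital Q -> context P Q -> is_invertible P.
Proof.
move=> uP uQ c; split=> //; exists Q; split=> //.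
- exists (tlift (cqp c)); exact: (ctx_biiso (ctx_sym c) hA uP.2).
- by apply: biiso_sym; exists (tlift (cpq c)); exact: (ctx_biiso c hA uQ.2).
Qed.

(** The two isomorphisms [a : P (x) Q ~ A] and [l : Q (x) P ~ A] need not be
    coherent. They give two isomorphisms [P (x) Q (x) P ~ P], which differ by
    an automorphism of [P]; twisting [a] by its inverse [v] makes them agree,
    which is the first associativity law. The second law follows because
    [a] detects zero in [Q]. *)
Lemma context_of_invertible P : is_invertible P ->
  exists2 Q : bimod A A, unital Q & inhabited (context P Q).
Proof.
move=> [uP [Q [uQ [l li] /biiso_sym[a ai]]]]; exists Q => //.
have [[ah _] [lh _]] := (ai, li).
have [idP idQ] := (biiso_id P, biiso_id Q); have [[idPh _] [idQh _]] := (idP, idQ).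
pose a1 := @lunit A A P \o tmap a (idfun : P -> P).
pose a2 := @runit A A P \o (tmap (idfun : P -> P) l \o @tassoc _ _ _ _ P Q P).
have a1i : is_biiso a1.
  exact: (biiso_comp (tmap_biiso ai idP) (lunit_biiso hA uP.1)).
have a2i : is_biiso a2.
  apply: biiso_comp (runit_biiso hA uP.2).
  exact: (biiso_comp (tassoc_biiso _ _ _) (tmap_biiso idP li)).
have a1E p q p' : a1 (pure (pure p q : tensor P Q) p') = a (pure p q) *< p'.
  by rewrite /a1 /= tmapE ?lunitE.
have a2E p q p' : a2 (pure (pure p q : tensor P Q) p') = p >* l (pure q p').
  by rewrite /a2 /= tassocE tmapE ?runitE.
have [b1 b1i [b1K b1K']] := biiso_inv a1i.
have [b2 b2i [b2K b2K']] := biiso_inv a2i.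
pose v := a2 \o b1; pose u := a1 \o b2.
have vi : is_biiso v by exact: (biiso_comp b1i a2i).
have [[uD uL uR] _] : is_biiso u by exact: (biiso_comp b2i a1i).
have uv p : u (v p) = p by rewrite /u /v /= b2K b1K'.
have ua2 t : u (a2 t) = a1 t by rewrite /u /= b2K.
have Fi := biiso_comp (tmap_biiso vi idQ) ai.
set F := (X in is_biiso X) in Fi; pose f (p : P) (q : Q) : A := F (pure p q).
have fp : is_pairing f := pairing_of_biiso Fi.
pose g (q : Q) (p : P) : A := l (pure q p).
have gp : is_pairing g := pairing_of_biiso li.
have fgA p q p' : f p q *< p' = p >* g q p'.
  have [vh _] := vi; rewrite /f /F /= tmapE //.
  by rewrite -[LHS](a1E (v p) q p') -ua2 a2E uR uv.
have nondeg (y : Q) : (forall p, f p y = 0) -> y = 0.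
  move=> y0; have [e <-] := lunital_fix hA uQ.1 y.
  have [_ _ _ /(_ e)[s ->]] := gp; rewrite lact_suml big1 // => x _.
  pose h := @lunit A A Q \o tmap l (idfun : Q -> Q).
  have hE q p q' : h (pure (pure q p : tensor Q P) q') = g q p *< q'.
    by rewrite /h /= tmapE ?lunitE.
  have hD : forall s t, h (s + t) = h s + h t.
    by have [[]] := biiso_comp (tmap_biiso li idQ) (lunit_biiso hA uQ.1).
  have py0 : pure x.2 y = 0.
    have [[FD _ _] /bij_inj Finj] := Fi.
    by apply: Finj; rewrite (add_map0 FD); exact: y0.
  rewrite -hE -tassocVE py0 pure0r (add_map0 (@tassocVD _ _ _ _ _ _ _)).
  exact: add_map0 hD.
have [[fDl fDr fM] fL fR _] := fp; have [[gDl gDr gM] gL gR _] := gp.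
have gfA q p q' : g q p *< q' = q >* f p q'.
  apply/eqP; rewrite -subr_eq0; apply/eqP/nondeg => p0.
  by rewrite (add_mapB (fDr p0)) -fM -fgA fL fR subrr.
by constructor; exact: Context fp gp fgA gfA.
Qed.

Lemma invertibleP P : is_invertible P <->
  unital P /\ exists2 Q : bimod A A, unital Q & inhabited (context P Q).
Proof.
split=> [Pi|[uP [Q uQ [c]]]]; last exact: invertible_of_context c.
by split; [case: Pi|exact: context_of_invertible].
Qed.

Lemma invertible_iso P P' : biiso P' P -> is_invertible P -> is_invertible P'.
Proof.
move=> [g gi] /invertibleP[uP [Q uQ [c]]]; have [c' _] := ctx_transport c gi.
apply: invertible_of_context uQ c'; apply: biiso_unital uP.
by apply: biiso_sym; exists g.
Qed.

Lemma invertible_tensor P P' :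
  is_invertible P -> is_invertible P' -> is_invertible (tensor P P').
Proof.
move=> /invertibleP[uP [Q uQ [c]]] /invertibleP[uP' [Q' uQ' [c']]].
apply: (@invertible_of_context _ (tensor Q' Q)); try exact: unital_tensor.
exact: (ctx_tensor hA uQ.1 uP'.1 c c').
Qed.

Lemma invertible_regular : is_invertible (regular A).
Proof.
have uA := unital_regular hA.
exact: (invertible_of_context uA uA (ctx_regular hA)).
Qed.

End Invertible.

(** * Groups of isomorphism classes *)

(** The common shape of [Pic] and [PSR]: the classes of the good objects, under
    a product that is associative and unital up to isomorphism. Right inverses
    up to isomorphism suffice, as in any monoid. *)
Section ClassGroup.
Variables (T : Type) (iso : T -> T -> Prop) (good : T -> Prop).
Variables (mul : T -> T -> T) (one : T).
Hypothesis iso_refl : forall x, iso x x.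
Hypothesis iso_sym : forall x y, iso x y -> iso y x.
Hypothesis iso_trans : forall x y z, iso x y -> iso y z -> iso x z.
Hypothesis iso_mul : forall x x' y y',
  good x -> good y -> iso x x' -> iso y y' -> iso (mul x y) (mul x' y').

Definition class_group : group_data :=
  GroupData (fun C => exists2 x, good x & C = iso x)
    (fun C D z => exists x y, [/\ C x, D y & iso (mul x y) z]) (iso one).

Lemma iso_classE x y : iso x y <-> iso x = iso y.
Proof.
split=> [xy|->]; last exact: iso_refl.
apply/funext => z; apply/propext; split; apply: iso_trans => //; exact: iso_sym.
Qed.

Lemma class_mulE x y : good x -> good y ->
  gmul class_group (iso x) (iso y) = iso (mul x y).
Proof.
move=> gx gy; apply/funext => z; apply/propext.
split=> [[x' [y' [xx' yy']]]|xyz]; first exact: iso_trans (iso_mul _ _ xx' yy').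
by exists x, y; split.
Qed.

Hypothesis mulA : forall x y z, good x -> good y -> good z ->
  iso (mul x (mul y z)) (mul (mul x y) z).
Hypothesis mul1 : forall x, good x -> iso (mul one x) x /\ iso (mul x one) x.
Hypothesis good_one : good one.
Hypothesis good_mul : forall x y, good x -> good y -> good (mul x y).
Hypothesis good_inv : forall x, good x -> exists2 y, good y & iso (mul x y) one.

Lemma class_groupP : is_group class_group.
Proof.
split=> [|_ _ [x gx ->] [y gy ->]|_ _ _ [x gx ->] [y gy ->] [z gz ->]
  |_ [x gx ->]|_ [x gx ->]].
- by exists one.
- by exists (mul x y); [exact: good_mul|rewrite class_mulE].
- by rewrite !class_mulE //; try exact: good_mul; apply/iso_classE/mulA.
- by rewrite !class_mulE //; split; apply/iso_classE; case: (mul1 gx).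
- have [y gy xy] := good_inv gx; have [z gz yz] := good_inv gy.
  exists (iso y); first by exists y.
  rewrite !class_mulE //; split; apply/iso_classE => //.
  have xz : iso x z.
    apply: iso_trans (iso_sym (mul1 gx).2) _.
    apply: iso_trans (iso_mul gx good_one (iso_refl x) (iso_sym yz)) _.
    apply: iso_trans (mulA gx gy gz) _.
    exact: iso_trans (iso_mul (good_mul gx gy) gz xy (iso_refl z)) (mul1 gz).1.
  exact: iso_trans (iso_mul gy gx (iso_refl y) xz) yz.
Qed.

End ClassGroup.

Lemma Pic_class_group (A : rng) : Pic A =
  class_group (@biiso A A) (@is_invertible A) (@tensor A A A) (regular A).
Proof. by []. Qed.

Lemma Pic_group (A : rng) : locally_unital A -> is_group (Pic A).
Proof.
move=> hA; rewrite Pic_class_group; apply: class_groupP.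
- exact: biiso_refl.
- exact: biiso_sym.
- exact: biiso_trans.
- by move=> *; exact: biiso_tensor.
- by move=> P Q K _ _ _; apply: biiso_sym; exists (@tassoc _ _ _ _ P Q K);
    exact: tassoc_biiso.
- move=> P [[uP uP'] _]; split; first by exists (@lunit A A P); exact: lunit_biiso.
  by exists (@runit A A P); exact: runit_biiso.
- exact: invertible_regular.
- by move=> P P'; exact: invertible_tensor.
- move=> P /(invertibleP hA)[uP [Q uQ [c]]]; exists Q.
    exact: invertible_of_context (ctx_sym c).
  by exists (tlift (cpq c)); exact: (ctx_biiso c hA uQ.2).
Qed.

Lemma Pic_mulE (A : rng) (P Q : bimod A A) :
  is_invertible P -> is_invertible Q ->
  gmul (Pic A) (biclass P) (biclass Q) = biclass (tensor P Q).
Proof.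
apply: (@class_mulE _ (@biiso A A) (@is_invertible A) (@tensor A A A) (regular A)).
- exact: biiso_refl.
- exact: biiso_trans.
- by move=> *; exact: biiso_tensor.
Qed.

Lemma biclassE (A : rng) (P Q : bimod A A) :
  biiso P Q <-> biclass P = biclass Q.
Proof. by apply: iso_classE; [exact: biiso_refl|exact: biiso_sym|exact: biiso_trans]. Qed.

Lemma Pic_biclass (A : rng) (hA : locally_unital A) (P : bimod A A) :
  gset (Pic A) (biclass P) <-> is_invertible P.
Proof.
split=> [[Q Qi /biclassE PQ]|Pi]; last by exists P.
exact: invertible_iso Qi.
Qed.

(** * Morphisms of Morita contexts along R in S *)

(** Local units for [S] taken inside [R], so that they can cross tensor signs
    over [R]. *)
Definition units_from (S : rng) (R : subring S) := forall s : seq S,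
  exists e : R, forall r, r \in s -> incl e ** r = r /\ r ** incl e = r.

Section Units.
Variables (S : rng) (R : subring S).

Lemma incl_inj : injective (@incl S R).
Proof. exact: sub_val_inj. Qed.

Lemma incl_sum I (s : seq I) (F : I -> R) :
  incl (\sum_(i <- s) F i) = \sum_(i <- s) incl (F i).
Proof. exact: (add_map_sum (f := @incl S R) (@inclD S R)). Qed.

Lemma extension_units (E : set S) : is_extension R E -> units_from R.
Proof.
move=> [ER _ [_ EU]] s; have [e /ER Re eP] := EU s.
by exists (sub_of (subring_addsub R) Re).
Qed.

Hypothesis hRS : units_from R.

Lemma units_from_S : locally_unital S.
Proof. by move=> s; have [e eP] := hRS s; exists (incl e). Qed.

Lemma units_from_R : locally_unital R.
Proof.
move=> s; have [e eP] := hRS (map (@incl S R) s); exists e => r rs.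
by have [] := eP (incl r) (map_f _ rs); split; apply: incl_inj.
Qed.

Lemma lunital_fixR B (X : bimod S B) : lunital X ->
  forall x : X, exists e : R, incl e *< x = x.
Proof.
move=> uX x; have [s ->] := uX x; have [e eP] := hRS (map fst s).
exists e; rewrite lact_sumr; apply: eq_big_seq => p ps.
by rewrite -lactA (eP p.1 _).1 // map_f.
Qed.

Lemma runital_fixR B (X : bimod B S) : runital X ->
  forall x : X, exists e : R, x >* incl e = x.
Proof.
move=> uX x; have [s ->] := uX x; have [e eP] := hRS (map snd s).
exists e; rewrite ract_suml; apply: eq_big_seq => p ps.
by rewrite -ractA (eP p.2 _).2 // map_f.
Qed.

End Units.

Section ContextMorphisms.
Variables (S : rng) (R : subring S).
Implicit Types (P Q : bimod R R) (X Y : bimod S S).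

Definition ctx_mor P Q X Y (c : context P Q) (d : context X Y)
    (phi : P -> X) (psi : Q -> Y) :=
  [/\ is_bihom (phi : P -> resl R (resr R X)),
      is_bihom (psi : Q -> resl R (resr R Y)),
      forall p q, incl (cpq c p q) = cpq d (phi p) (psi q)
    & forall q p, incl (cqp c q p) = cqp d (psi q) (phi p)].

Lemma ctx_mor_sym P Q X Y (c : context P Q) (d : context X Y) phi psi :
  ctx_mor c d phi psi -> ctx_mor (ctx_sym c) (ctx_sym d) psi phi.
Proof. by case. Qed.

Hypothesis hRS : units_from R.
Let hS := units_from_S hRS.
Let hR := units_from_R hRS.

Section FromMorphism.
Variables (P Q : bimod R R) (X Y : bimod S S).
Variables (c : context P Q) (d : context X Y) (phi : P -> X) (psi : Q -> Y).
Hypotheses (uP : unital P) (uX : unital X) (cd : ctx_mor c d phi psi).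
Let T := Triple phi.

Let phiD x y : phi (x + y) = phi x + phi y.
Proof. by have [[fD _ _] _ _ _] := cd; exact: fD. Qed.
Let phiL (r : R) p : phi (r *< p) = incl r *< phi p.
Proof. by have [[_ fL _] _ _ _] := cd; exact: fL. Qed.
Let phiR p (r : R) : phi (p >* r) = phi p >* incl r.
Proof. by have [[_ _ fR] _ _ _] := cd; exact: fR. Qed.
Let cdpq p q : incl (cpq c p q) = cpq d (phi p) (psi q).
Proof. by have [] := cd. Qed.
Let cdqp q p : incl (cqp c q p) = cqp d (psi q) (phi p).
Proof. by have [] := cd. Qed.

Let rb : balanced (fun (p : P) (s : S_RS R) => phi p >* (s : S)).
Proof.
split=> [p p' s|p s s'|p r s]; rewrite ?phiD ?ractDl ?ractDr //.
by rewrite phiR -ractA.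
Qed.

Let lb : balanced (fun (s : S_SR R) (p : P) => (s : S) *< phi p).
Proof.
split=> [s s' p|s p p'|s r p]; rewrite ?phiD ?lactDl ?lactDr //.
by rewrite phiL -lactA.
Qed.

(** Let [e = \sum_i cpq c p_i q_i] be a left unit. Moving scalars across the
    tensor sign gives [t = e t = \sum_i pure p_i (cqp d (psi q_i) (phi_r t))],
    hence injectivity; with [x] in place of [phi_r t] the same sum is a preimage
    of [x]. *)
Lemma ctx_phi_r : is_biiso (@phi_r S R T).
Proof.
have phiE p s : phi_r (pure p (s : S_RS R) : tensor (triple_P T) (S_RS R)) =
    phi p >* (s : S).
  exact: (tliftE rb).
have rD u v : @phi_r S R T (u + v) = phi_r u + phi_r v := tliftD rb u v.
split.
  apply: tlift_bihom => // [r p s|p s s']; first by rewrite [triple_phi _]phiL -lractA.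
  by rewrite -ractA.
apply: (add_map_bij rD) => [t|x]; last first.
  have [e <-] := lunital_fixR hRS uX.1 x; have [s ->] := cpq_onto c e.
  exists (\sum_(y <- s) pure y.1 (cqp d (psi y.2) x : S_RS R)).
  rewrite (add_map_sum rD) incl_sum lact_suml; apply: eq_bigr => y _.
  by rewrite cdpq cpqA; exact: phiE.
have [e te] := lunital_fix hR (lunital_tensor (N := S_RS R) uP.1) t.
have [s es] := cpq_onto c e.
have tE : t = \sum_(y <- s) pure y.1 (cqp d (psi y.2) (@phi_r S R T t) : S_RS R).
  rewrite -[LHS]te {}es lact_suml; apply: eq_bigr => y _.
  move: (t); apply: tensor_ind => [p z|u v eu ev].
    by rewrite lact_pure cpqA pureA phiE cqpR -cdqp.
  by rewrite lactDr eu ev -pureDr rD cqpDr.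
by move=> t0; rewrite tE t0 big1 // => y _; rewrite cqp0r pure0r.
Qed.

(** The mirror image: a right unit [\sum_i cqp c q_i p_i] gives
    [t = \sum_i pure (cpq d (phi_l t) (psi q_i)) p_i]. *)
Lemma ctx_phi_l : is_biiso (@phi_l S R T).
Proof.
have phiE s p : phi_l (pure (s : S_SR R) p : tensor (S_SR R) (triple_P T)) =
    (s : S) *< phi p.
  exact: (tliftE lb).
have lD u v : @phi_l S R T (u + v) = phi_l u + phi_l v := tliftD lb u v.
split.
  apply: tlift_bihom => // [s' s p|s p r]; first by rewrite -lactA.
  by rewrite [triple_phi _]phiR lractA.
apply: (add_map_bij lD) => [t|x]; last first.
  have [e <-] := runital_fixR hRS uX.2 x; have [s ->] := cqp_onto c e.
  exists (\sum_(y <- s) pure (cpq d x (psi y.1) : S_SR R) y.2).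
  rewrite (add_map_sum lD) incl_sum ract_sumr; apply: eq_bigr => y _.
  by rewrite cdqp -cpqA; exact: phiE.
have [e te] := runital_fix hR (runital_tensor (M := S_SR R) uP.2) t.
have [s es] := cqp_onto c e.
have tE : t = \sum_(y <- s) pure (cpq d (@phi_l S R T t) (psi y.1) : S_SR R) y.2.
  rewrite -[LHS]te {}es ract_sumr; apply: eq_bigr => y _.
  move: (t); apply: tensor_ind => [z p|u v eu ev].
    by rewrite ract_pure -cpqA -pureA phiE cpqL -cdpq.
  by rewrite ractDl eu ev -pureDl lD cpqDl.
by move=> t0; rewrite tE t0 big1 // => y _; rewrite cpq0l pure0l.
Qed.

Lemma ctx_triple : is_triple T.
Proof. by split=> //; [exact: ctx_phi_r|exact: ctx_phi_l]. Qed.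

(** If [phi p = 0] then every [cqp c q p] vanishes, being equal in [S] to
    [cqp d (psi q) (phi p)]. *)
Lemma ctx_mor_inj : injective phi.
Proof.
move=> p p' pp'; apply/eqP; rewrite -subr_eq0; apply/eqP.
apply: (cqp_nondeg (c := c) hR uP.1) => q; apply: incl_inj.
by rewrite cdqp (add_mapB phiD) pp' subrr cqp0r.
Qed.

End FromMorphism.
End ContextMorphisms.

(** * The group of triples *)

Section Triples.
Variables (S : rng) (R : subring S).
Implicit Types (T U V : triple R).

Lemma triple_iso_of T U (f : triple_P T -> triple_P U)
    (g : triple_X T -> triple_X U) : is_biiso f -> is_biiso g ->
  (forall p, g (triple_phi p) = triple_phi (f p)) -> triple_iso T U.
Proof.
move=> fi gi fg; have [f' [fh' _] [fK fK']] := biiso_inv fi.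
have [g' [gh' _] [gK gK']] := biiso_inv gi.
case: fi gi => fh _ [gh _]; exists f, g, f', g'; split=> //; split=> // p.
by apply: (can_inj gK); rewrite gK' fg fK'.
Qed.

Lemma triple_iso_biiso T U : triple_iso T U ->
  exists (f : triple_P T -> triple_P U) (g : triple_X T -> triple_X U),
    [/\ is_biiso f, is_biiso g & forall p, g (triple_phi p) = triple_phi (f p)].
Proof.
move=> [f [g [f' [g' [[fh gh fg] _ [fK fK'] [gK gK']]]]]]; exists f, g.
by split=> //; split=> //; [exists f'|exists g'].
Qed.

Lemma triple_iso_refl T : triple_iso T T.
Proof. by apply: (triple_iso_of (biiso_id _) (biiso_id _)). Qed.

Lemma triple_iso_sym T U : triple_iso T U -> triple_iso U T.
Proof. by move=> [f [g [f' [g' [? ? [? ?] [? ?]]]]]]; exists f', g', f, g. Qed.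

Lemma triple_iso_trans T U V : triple_iso T U -> triple_iso U V -> triple_iso T V.
Proof.
move=> /triple_iso_biiso[f [g [fi gi fg]]].
move=> /triple_iso_biiso[f' [g' [fi' gi' fg']]].
apply: (triple_iso_of (biiso_comp fi fi') (biiso_comp gi gi')) => p.
by rewrite /= fg fg'.
Qed.

Lemma triple_iso_X T U : triple_iso T U -> biiso (triple_X T) (triple_X U).
Proof. by move=> /triple_iso_biiso[f [g [_ gi _]]]; exists g. Qed.

Definition bihom_phi T :=
  is_bihom (@triple_phi S R T : triple_P T -> resl R (resr R (triple_X T))).

Section Mul.
Variables (T U : triple R) (hT : bihom_phi T) (hU : bihom_phi U).

Lemma triple_mul_balanced :
  balanced (fun (p : triple_P T) (q : triple_P U) => pure (triple_phi p) (triple_phi q)).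
Proof.
move: hT hU => [TD _ TR] [UD UL _].
split=> [p p' q|p q q'|p r q]; rewrite ?TD ?UD ?pureDl ?pureDr //.
by rewrite TR UL [LHS]pureA.
Qed.

Lemma triple_mulE p q :
  @triple_phi S R (triple_mul T U) (pure p q) = pure (triple_phi p) (triple_phi q).
Proof. exact: (tliftE triple_mul_balanced). Qed.

Lemma triple_mulD x y : @triple_phi S R (triple_mul T U) (x + y) =
  @triple_phi S R (triple_mul T U) x + @triple_phi S R (triple_mul T U) y.
Proof. exact: (tliftD triple_mul_balanced). Qed.

Lemma triple_mul_bihom : bihom_phi (triple_mul T U).
Proof.
move: (hT) (hU) => [_ TL _] [_ _ UR].
split=> [x y|r|x r]; first exact: triple_mulD.
- apply: tensor_ind => [p q|x y ex ey].
    by rewrite lact_pure triple_mulE TL triple_mulE [RHS]lact_pure.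
  by rewrite lactDr !triple_mulD lactDr ex ey.
- move: x; apply: tensor_ind => [p q|x y ex ey].
    by rewrite ract_pure triple_mulE UR triple_mulE [RHS]ract_pure.
  by rewrite ractDl !triple_mulD ractDl ex ey.
Qed.

End Mul.
End Triples.

Section TripleLaws.
Variables (S : rng) (R : subring S).
Implicit Types (T U V : triple R).

Lemma bihom_phi_iso T T' : triple_iso T T' -> bihom_phi T -> bihom_phi T'.
Proof.
move=> /triple_iso_sym/triple_iso_biiso[f [g [[[fD fL fR] _] gi fg]]] [TD TL TR].
have [[gD gL gR] /bij_inj ginj] := gi.
split=> *; apply: ginj; rewrite ?gD fg ?fD ?fL ?fR ?TD ?TL ?TR -?fg //.
- by rewrite [RHS]gL.
- by rewrite [RHS]gR.
Qed.

Lemma triple_iso_mul T T' U U' : bihom_phi T -> bihom_phi U ->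
  triple_iso T T' -> triple_iso U U' ->
  triple_iso (triple_mul T U) (triple_mul T' U').
Proof.
move=> hT hU TT' UU'; have [hT' hU'] := (bihom_phi_iso TT' hT, bihom_phi_iso UU' hU).
move: TT' UU' => /triple_iso_biiso[f [g [fi gi fg]]].
move=> /triple_iso_biiso[f' [g' [fi' gi' fg']]].
have [[fh _] [gh _]] := (fi, gi); have [[fh' _] [gh' _]] := (fi', gi').
apply: (@triple_iso_of _ _ (triple_mul T U) (triple_mul T' U')
  (tmap f f') (tmap g g')); try exact: tmap_biiso.
have [fD _ _] := tmap_bihom fh fh'; have [gD _ _] := tmap_bihom gh gh'.
apply: tensor_ind => [p q|x y ex ey].
  by rewrite triple_mulE // !tmapE // triple_mulE // fg fg'.
by rewrite fD !triple_mulD // gD ex ey.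
Qed.

Lemma triple_mul_assoc T U V : bihom_phi T -> bihom_phi U -> bihom_phi V ->
  triple_iso (triple_mul T (triple_mul U V)) (triple_mul (triple_mul T U) V).
Proof.
move=> hT hU hV; apply: triple_iso_sym.
have [hTU hUV] := (triple_mul_bihom hT hU, triple_mul_bihom hU hV).
apply: (@triple_iso_of _ _ (triple_mul (triple_mul T U) V)
  (triple_mul T (triple_mul U V)) _ _ (tassoc_biiso _ _ _) (tassoc_biiso _ _ _)).
apply: tensor_ind3 => [p q r|x y ex ey].
  by rewrite tassocE !triple_mulE // [tassoc _]tassocE.
by rewrite tassocD !triple_mulD // -ex -ey [LHS]tassocD.
Qed.

Definition triple_one : triple R :=
  @Triple S R (regular R) (regular S) (@incl S R).

Lemma triple_mul1l T : locally_unital R -> locally_unital S ->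
  lunital (triple_P T) -> lunital (triple_X T) -> bihom_phi T ->
  triple_iso (triple_mul triple_one T) T.
Proof.
move=> hR hS uP uX hT; have h1 : bihom_phi triple_one by [].
have [[lD _ _] _] := lunit_biiso hR uP; have [[lD' _ _] _] := lunit_biiso hS uX.
apply: (@triple_iso_of _ _ (triple_mul triple_one T) T _ _
  (lunit_biiso hR uP) (lunit_biiso hS uX)).
apply: tensor_ind => [r p|x y ex ey].
  by rewrite triple_mulE // !lunitE; have [_ -> _] := hT.
by have [TD _ _] := hT; rewrite triple_mulD // lD lD' TD ex ey.
Qed.

Lemma triple_mul1r T : locally_unital R -> locally_unital S ->
  runital (triple_P T) -> runital (triple_X T) -> bihom_phi T ->
  triple_iso (triple_mul T triple_one) T.
Proof.
move=> hR hS uP uX hT; have h1 : bihom_phi triple_one by [].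
have [[rD _ _] _] := runit_biiso hR uP; have [[rD' _ _] _] := runit_biiso hS uX.
apply: (@triple_iso_of _ _ (triple_mul T triple_one) T _ _
  (runit_biiso hR uP) (runit_biiso hS uX)).
apply: tensor_ind => [p r|x y ex ey].
  by rewrite triple_mulE // !runitE; have [_ _ ->] := hT.
by have [TD _ _] := hT; rewrite triple_mulD // rD rD' TD ex ey.
Qed.

End TripleLaws.

(** * Invertible triples are morphisms of Morita contexts *)

Section InvertibleTriples.
Variables (S : rng) (R : subring S) (hRS : units_from R).
Let hS := units_from_S hRS.
Let hR := units_from_R hRS.
Implicit Types (T U : triple R).

(** [psi q] is the element of [Y] that pairs with [phi p] to the same value as
    [q] with [p]. It is unique because the image of [phi] generates [X]. For
    existence write a right unit [e] of [q] as [\sum_k cpq d (phi p_k) y_k] and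
    take [\sum_k cqp c q p_k *< y_k]. *)
Lemma triple_ctx_mor T (Q : bimod R R) (Y : bimod S S)
    (c : context (triple_P T) Q) (d : context (triple_X T) Y) :
  is_triple T -> unital Q -> unital Y ->
  exists psi, ctx_mor c d (@triple_phi S R T) psi.
Proof.
move=> [uP uX [phiD phiL phiR] [[rD _ _] [r' _ rK]] [[lD _ _] [l' _ lK]]] uQ uY.
set phi := @triple_phi S R T in phiD phiL phiR.
have genr x : exists s : seq (triple_P T * S), x = \sum_(z <- s) phi z.1 >* z.2.
  have [s rs] := tensor_sum (r' x); exists s; rewrite -[LHS]rK rs (add_map_sum rD).
  apply: eq_bigr => z _; apply: tliftE.
  split=> [p p' a|p a a'|p a b]; rewrite ?[triple_phi (_ + _)]phiD ?ractDl ?ractDr //.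
  by rewrite [triple_phi _]phiR -ractA.
have genl x : exists s : seq (S * triple_P T), x = \sum_(z <- s) z.1 *< phi z.2.
  have [s ls] := tensor_sum (l' x); exists s; rewrite -[LHS]lK ls (add_map_sum lD).
  apply: eq_bigr => z _; apply: tliftE.
  split=> [a a' p|a p p'|a b p]; rewrite ?[triple_phi (_ + _)]phiD ?lactDl ?lactDr //.
  by rewrite [triple_phi (_ *< _)]phiL -lactA.
have uniq0 y : (forall p, cpq d (phi p) y = 0) -> y = 0.
  move=> y0; apply: (cqp_nondeg (c := ctx_sym d) hS uY.1) => x /=.
  have [s ->] := genl x; rewrite cpq_suml big1 // => z _.
  by rewrite cpqL y0 -[z.1 ** 0]/((z.1 : S) *< (0 : regular S)) lact0r.
have uniq y y' : (forall p, cpq d (phi p) y = cpq d (phi p) y') -> y = y'.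
  move=> yy'; apply/eqP; rewrite -subr_eq0; apply/eqP/uniq0 => p.
  by rewrite (add_mapB (cpqDr d _)) yy' subrr.
have exist q : exists y, forall p, cpq d (phi p) y = incl (cpq c p q).
  have [e qe] := runital_fix hR uQ.2 q.
  have [s es] : exists s : seq (triple_P T * Y),
      incl e = \sum_(z <- s) cpq d (phi z.1) z.2.
    have [s ->] := cpq_onto d (incl e).
    apply: (sum_closure (g := fun z => cpq d (phi z.1) z.2)) => z.
    have [r ->] := genr z.1; exists [seq (w.1, w.2 *< z.2) | w <- r].
    rewrite big_map cpq_suml; apply: eq_bigr => w _; exact: cpqM.
  exists (\sum_(z <- s) incl (cqp c q z.1) *< z.2) => p.
  rewrite -[in RHS]qe cpqR inclM es cpq_sumr.
  rewrite -[RHS]/((incl (cpq c p q) : S) *<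
    (\sum_(z <- s) cpq d (phi z.1) z.2 : regular S)).
  rewrite lact_sumr; apply: eq_bigr => z _.
  rewrite -cpqM -[RHS]cpqL; congr (cpq d _ _).
  by rewrite -[LHS]phiR -[RHS]phiL cpqA.
have [psi psiE] := choice exist; exists psi.
have psih : is_bihom (psi : Q -> resl R (resr R Y)).
  split=> [q q'|r q|q r]; apply: uniq => p.
  - by rewrite cpqDr !psiE cpqDr.
  - by rewrite psiE -cpqM -psiE phiR; exact: cpqM.
  - by rewrite psiE cpqR inclM -psiE; exact/esym/cpqR.
split=> // q p.
apply/eqP; rewrite -subr_eq0; apply/eqP; set z := _ - _.
have xz (x : triple_X T) : x >* (z : S) = 0.
  have [s ->] := genl x; rewrite ract_suml big1 // => w _; rewrite lractA.
  rewrite /z -[- _]opprK opprK (add_mapB (ractDr _)) -cpqA psiE.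
  by rewrite -[phi w.2 >* _]phiR -[_ *< phi p]phiL cpqA subrr lact0r.
have [e ez] := hS [:: z]; have [<- _] := ez z (mem_head _ _).
have [s ->] := cqp_onto d e.
rewrite -[LHS]/((\sum_(w <- s) cqp d w.1 w.2 : S) *< (z : regular S)) lact_suml.
by rewrite big1 // => w _; rewrite -[LHS]cqpR xz cqp0r.
Qed.

(** The description of the elements of [PSR] used in the rest of the argument:
    it exhibits the inverse [Q], [Y], [psi] and is symmetric in the two
    triples. *)
Definition linked T := exists (Q : bimod R R) (Y : bimod S S)
    (c : context (triple_P T) Q) (d : context (triple_X T) Y) (psi : Q -> Y),
  [/\ unital (triple_P T), unital (triple_X T), unital Q, unital Y
    & ctx_mor c d (@triple_phi S R T) psi].

Definition invertible_triple T := [/\ is_triple T,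
  gset (Pic R) (biclass (triple_P T)) & gset (Pic S) (biclass (triple_X T))].

Lemma invertible_tripleP T : invertible_triple T <-> linked T.
Proof.
split=> [[hT /(Pic_biclass hR) Pi /(Pic_biclass hS) Xi]|[Q [Y [c [d [psi]]]]]].
  have [uP [Q uQ [c]]] := (invertibleP hR _).1 Pi.
  have [uX [Y uY [d]]] := (invertibleP hS _).1 Xi.
  by have [psi cd] := triple_ctx_mor c d hT uQ uY; exists Q, Y, c, d, psi.
move=> [uP uX uQ uY cd]; split.
- by have := ctx_triple hRS uP uX cd; case: (T).
- by apply/(Pic_biclass hR)/(invertibleP hR); split=> //; exists Q.
- by apply/(Pic_biclass hS)/(invertibleP hS); split=> //; exists Y.
Qed.

Lemma linked_bihom T : linked T -> bihom_phi T.
Proof. by move=> [Q [Y [c [d [psi [_ _ _ _ []]]]]]]. Qed.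

Lemma linked_inj T : linked T -> injective (@triple_phi S R T).
Proof. by move=> [Q [Y [c [d [psi [uP _ _ _ cd]]]]]]; exact: (ctx_mor_inj hRS uP cd). Qed.

Lemma linked_one : linked (triple_one R).
Proof.
have [uR uS] := (unital_regular hR, unital_regular hS).
by exists (regular R), (regular S), (ctx_regular hR), (ctx_regular hS), (@incl S R).
Qed.

Lemma ctx_mor_tensor P Q X Y P' Q' X' Y' (c : @context R P Q) (d : @context S X Y)
    (c' : @context R P' Q') (d' : @context S X' Y') phi psi phi' psi' t u :
  ctx_mor c d phi psi -> ctx_mor c' d' phi' psi' ->
  incl (tpair c c' t u) =
  tpair d d' (@triple_phi S R (triple_mul (Triple phi) (Triple phi')) t)
    (@triple_phi S R (triple_mul (Triple psi') (Triple psi)) u).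
Proof.
move=> [h1 h2 e1 _] [h1' h2' e1' _].
have [[_ h1L _] [_ h2L _]] := (h1, h2).
move: t u; apply: tensor_ind2 => [p p' q' q|x y u ex ey|x u v ex ey].
- by rewrite !triple_mulE // !tpairE e1 h2L [triple_phi _ in RHS]/= -e1'.
- by rewrite tpairDl triple_mulD // tpairDl inclD ex ey.
- by rewrite tpairDr triple_mulD // tpairDr inclD ex ey.
Qed.

(** The inverse of a product is the product of the inverses in the opposite
    order, and [ctx_tensor] provides the two contexts. *)
Lemma linked_mul T U : linked T -> linked U -> linked (triple_mul T U).
Proof.
case: T U => [P X phi] [P' X' phi'].
move=> [Q [Y [c [d [psi [uP uX uQ uY cd]]]]]].
move=> [Q' [Y' [c' [d' [psi' [uP' uX' uQ' uY' cd']]]]]].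
exists (tensor Q' Q), (tensor Y' Y), (ctx_tensor hR uQ.1 uP'.1 c c').
exists (ctx_tensor hS uY.1 uX'.1 d d').
exists (@triple_phi S R (triple_mul (Triple psi') (Triple psi))).
split; try exact: unital_tensor.
have [h1 h2 _ _] := cd; have [h1' h2' _ _] := cd'.
split=> [||t u|u t].
- exact: (triple_mul_bihom h1 h1').
- exact: (@triple_mul_bihom _ _ (Triple psi') (Triple psi) h2' h2).
- exact (ctx_mor_tensor t u cd cd').
- exact: (ctx_mor_tensor u t (ctx_mor_sym cd') (ctx_mor_sym cd)).
Qed.

(** The second half of the context morphism is a triple again, and it is the
    inverse: the pairings themselves are the isomorphisms. *)
Lemma linked_inv T : linked T ->
  exists2 U, linked U & triple_iso (triple_mul T U) (triple_one R).
Proof.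
case: T => [P X phi] [Q [Y [c [d [psi [uP uX uQ uY cd]]]]]].
exists (Triple psi).
  by exists P, X, (ctx_sym c), (ctx_sym d), phi; split=> //; exact: ctx_mor_sym.
apply: (@triple_iso_of _ _ (triple_mul (Triple phi) (Triple psi)) (triple_one R)
  _ _ (ctx_biiso c hR uQ.2) (ctx_biiso d hS uY.2)).
have [h1 h2 e _] := cd.
have hT : bihom_phi (Triple phi) := h1; have hU : bihom_phi (Triple psi) := h2.
have cb : balanced (cpq c) by have [] := cpq_pairing c.
have db : balanced (cpq d) by have [] := cpq_pairing d.
apply: tensor_ind => [p q|x y ex ey].
  by rewrite triple_mulE // !tliftE //; exact/esym/e.
by rewrite triple_mulD // (tliftD db) ex ey (tliftD cb).
Qed.

Lemma PSR_group : is_group (PSR R).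
Proof.
apply: (@class_groupP _ (@triple_iso S R) invertible_triple
  (@triple_mul S R) (triple_one R)).
- exact: triple_iso_refl.
- exact: triple_iso_sym.
- exact: triple_iso_trans.
- by move=> T T' U U' [[_ _ ? _ _] _ _] [[_ _ ? _ _] _ _]; exact: triple_iso_mul.
- move=> T U V [[_ _ ? _ _] _ _] [[_ _ ? _ _] _ _] [[_ _ ? _ _] _ _].
  exact: triple_mul_assoc.
- move=> T [[[uP uP'] [uX uX'] hT _ _] _ _].
  by split; [exact: triple_mul1l|exact: triple_mul1r].
- exact/invertible_tripleP/linked_one.
- move=> T U /invertible_tripleP hT /invertible_tripleP hU.
  exact/invertible_tripleP/linked_mul.
- move=> T /invertible_tripleP/linked_inv[U hU TU]; exists U => //.
  exact/invertible_tripleP.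
Qed.

Lemma triple_classE T U : triple_iso T U <-> triple_class T = triple_class U.
Proof.
by apply: iso_classE; [exact: triple_iso_refl|exact: triple_iso_sym|exact: triple_iso_trans].
Qed.

Lemma PSR_mulE T U : linked T -> linked U ->
  gmul (PSR R) (triple_class T) (triple_class U) = triple_class (triple_mul T U).
Proof.
move=> /invertible_tripleP hT /invertible_tripleP hU.
apply: (@class_mulE _ (@triple_iso S R) invertible_triple
  (@triple_mul S R) (triple_one R)) => //.
- exact: triple_iso_refl.
- exact: triple_iso_trans.
- by move=> V V' W W' [[_ _ ? _ _] _ _] [[_ _ ? _ _] _ _]; exact: triple_iso_mul.
Qed.

Lemma PSR_class T : linked T -> gset (PSR R) (triple_class T).
Proof. by move=> /invertible_tripleP hT; exists T. Qed.

Lemma map_Or_class T : map_Or (triple_class T) = biclass (triple_X T).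
Proof.
apply/funext => Z; apply/propext; split=> [[U TU]|TZ].
  by apply: biiso_trans; exact: triple_iso_X.
by exists T => //; exact: triple_iso_refl.
Qed.

Lemma map_Or_hom : @is_group_hom (PSR R) (Pic S) (@map_Or S R).
Proof.
split=> [_ [T hT ->]|_ _ [T hT ->] [U hU ->]].
  by rewrite map_Or_class; case: hT.
have [lT lU] := ((invertible_tripleP T).1 hT, (invertible_tripleP U).1 hU).
rewrite PSR_mulE // !map_Or_class Pic_mulE //.
- by case: hT => _ _ /(Pic_biclass hS).
- by case: hU => _ _ /(Pic_biclass hS).
Qed.

End InvertibleTriples.

(** * Invertible sub-bimodules of S *)

Section MulSet.
Variable S : rng.
Implicit Types W V U Z : set S.

Lemma mul_set0 W V : mul_set W V 0.
Proof. by exists [::]; rewrite big_nil. Qed.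

Lemma mul_setD W V x y : mul_set W V x -> mul_set W V y -> mul_set W V (x + y).
Proof.
move=> [s [sP ->]] [r [rP ->]]; exists (s ++ r); rewrite big_cat; split=> // p.
by rewrite mem_cat => /orP[/sP|/rP].
Qed.

Lemma mul_setM W V w v : W w -> V v -> mul_set W V (w ** v).
Proof.
move=> Ww Vv; exists [:: (w, v)]; rewrite big_seq1; split=> // p.
by rewrite inE => /eqP->.
Qed.

Lemma mul_set_sub W V Z : Z 0 -> (forall x y, Z x -> Z y -> Z (x + y)) ->
  (forall w v, W w -> V v -> Z (w ** v)) -> mul_set W V `<=` Z.
Proof.
move=> Z0 ZD ZM _ [s [sP ->]]; rewrite big_seq; apply: (big_ind Z) => // p ps.
by have [Wp Vp] := sP p ps; exact: ZM.
Qed.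

Lemma rmul0l (x : S) : 0 ** x = 0.
Proof. exact: (lact0l (x : regular S)). Qed.

Lemma rmul0r (x : S) : x ** 0 = 0.
Proof. exact: (ract0r (x : regular S)). Qed.

Lemma rmulBl (x y z : S) : (x - y) ** z = x ** z - y ** z.
Proof. exact: (add_mapB (f := fun x => x ** z) (fun x y => rmulDl x y z)). Qed.

Lemma mul_setA W V U : mul_set W (mul_set V U) = mul_set (mul_set W V) U.
Proof.
apply/seteqP; split; apply: mul_set_sub; try exact: mul_set0; try exact: mul_setD.
- move=> w x Ww; move: x; apply: mul_set_sub => [|x y|v u Vv Uu].
  + by rewrite rmul0r; exact: mul_set0.
  + by rewrite rmulDr; exact: mul_setD.
  + by rewrite rmulA; do 2?apply: mul_setM.
- move=> x u + Uu; move: x; apply: mul_set_sub => [|x y|w v Ww Vv].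
  + by rewrite rmul0l; exact: mul_set0.
  + by rewrite rmulDl; exact: mul_setD.
  + by rewrite -rmulA; do 2?apply: mul_setM.
Qed.

Lemma mul_set_addsub W V : (forall w, W w -> W (- w)) -> is_addsub (mul_set W V).
Proof.
move=> WN; split=> [|x y hx hy]; first exact: mul_set0.
apply: mul_setD => //; move: y hy; apply: mul_set_sub => [|x' y|w v Ww Vv].
- by rewrite oppr0; exact: mul_set0.
- by rewrite opprD; exact: mul_setD.
- by rewrite -sub0r -(rmul0l v) -rmulBl sub0r; apply: mul_setM => //; exact: WN.
Qed.

(** Turns equations such as [mul_set R X = X] into the sums demanded by
    [unital] and [is_pairing]. *)
Lemma mul_set_sum W V (hW : is_addsub W) (hV : is_addsub V) x : mul_set W V x ->
  exists s : seq (sub_zmod hW * sub_zmod hV),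
    x = \sum_(p <- s) sub_val p.1 ** sub_val p.2.
Proof.
move: x; apply: mul_set_sub => [|x y [s ->] [r ->]|w v Ww Vv].
- by exists [::]; rewrite big_nil.
- by exists (s ++ r); rewrite big_cat.
- by exists [:: (sub_of hW Ww, sub_of hV Vv)]; rewrite big_seq1.
Qed.

End MulSet.

Section InvGroup.
Variables (S : rng) (R : subring S) (hRS : units_from R).
Let hS := units_from_S hRS.
Let hR := units_from_R hRS.
Implicit Types X Y : set S.

Definition subRR X := is_subbimod (X : set (S_RR R)).

Lemma subRRP X : subRR X <-> [/\ is_addsub X,
  forall r x, subring_set R r -> X x -> X (r ** x)
  & forall x r, subring_set R r -> X x -> X (x ** r)].
Proof.
split=> [[aX lX rX]|[aX lX rX]]; split=> //.
- by move=> r x Rr; exact: (lX (sub_of (subring_addsub R) Rr)).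
- by move=> x r Rr Xx; exact: (rX x (sub_of (subring_addsub R) Rr) Xx).
- by move=> r x; apply: lX; exact: sub_valP.
- by move=> x r; apply: rX; exact: sub_valP.
Qed.

Lemma addsubN (V : zmodType) (X : set V) : is_addsub X -> forall x, X x -> X (- x).
Proof. by move=> [X0 XB] x Xx; rewrite -sub0r; exact: XB. Qed.

Lemma addsubD (V : zmodType) (X : set V) : is_addsub X ->
  forall x y, X x -> X y -> X (x + y).
Proof. by move=> aX x y Xx Xy; rewrite -[y]opprK; apply: aX.2 => //; exact: addsubN. Qed.

Lemma subRR_R : subRR R.
Proof.
apply/subRRP; split; first exact: subring_addsub.
- by move=> r x; exact: subring_mul.
- by move=> r x ? ?; exact: subring_mul.
Qed.

Lemma subRR_mul X Y : subRR X -> subRR Y -> subRR (mul_set X Y).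
Proof.
move=> /subRRP[aX lX _] /subRRP[_ _ rY]; apply/subRRP; split.
- exact: mul_set_addsub (addsubN aX).
- move=> r x Rr; move: x; apply: mul_set_sub => [|x y|w v Ww Vv].
  + by rewrite rmul0r; exact: mul_set0.
  + by rewrite rmulDr; exact: mul_setD.
  + by rewrite rmulA; apply: mul_setM => //; exact: lX.
- move=> x r Rr; move: x; apply: mul_set_sub => [|x y|w v Ww Vv].
  + by rewrite rmul0l; exact: mul_set0.
  + by rewrite rmulDl; exact: mul_setD.
  + by rewrite -rmulA; apply: mul_setM => //; exact: rY.
Qed.

Lemma mul_setRR : mul_set R R = R.
Proof.
apply/seteqP; split=> [|r Rr].
  apply: mul_set_sub; [|exact: addsubD (subring_addsub R)|exact: subring_mul].
  by have [] := subring_addsub R.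
have [e eP] := hRS [:: r]; have [<- _] := eP r (mem_head _ _).
by apply: mul_setM => //; exact: sub_valP.
Qed.

(** An inverse [Y] need not be unital, but [R Y R] is, and is still an
    inverse. *)
Lemma Inv_inverse X : gset (Inv R) X ->
  exists2 Y, gset (Inv R) Y & mul_set X Y = R /\ mul_set Y X = R.
Proof.
move=> [hX RX XR [Y [hY XY YX]]]; exists (mul_set R (mul_set Y R)); last first.
  by rewrite !mul_setA XR XY mul_setRR -!mul_setA RX YX mul_setRR.
split.
- exact: subRR_mul subRR_R (subRR_mul hY subRR_R).
- by rewrite mul_setA mul_setRR.
- by rewrite -!mul_setA mul_setRR.
- exists X; split=> //.
    by rewrite -!mul_setA RX YX mul_setRR.
  by rewrite !mul_setA XR XY mul_setRR.
Qed.

Lemma Inv_mul X Y : gset (Inv R) X -> gset (Inv R) Y -> gset (Inv R) (mul_set X Y).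
Proof.
move=> [hX RX XR [X' [hX' XX' X'X]]] [hY RY YR [Y' [hY' YY' Y'Y]]]; split.
- exact: subRR_mul.
- by rewrite mul_setA RX.
- by rewrite -mul_setA YR.
- exists (mul_set Y' X'); split; first exact: subRR_mul.
    by rewrite -mul_setA [mul_set Y _]mul_setA YY' mul_setA XR XX'.
  by rewrite -mul_setA [mul_set X' _]mul_setA X'X RY Y'Y.
Qed.

Lemma Inv_one : gset (Inv R) (R : set S).
Proof.
by split; [exact: subRR_R|exact: mul_setRR|exact: mul_setRR|exists R; split=> //;
  [exact: subRR_R|exact: mul_setRR|exact: mul_setRR]].
Qed.

Lemma Inv_group : is_group (Inv R).
Proof.
split=> [|X Y|X Y Z _ _ _|X [_ RX XR _]|X /Inv_inverse[Y hY []]].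
- exact: Inv_one.
- exact: Inv_mul.
- exact: mul_setA.
- by [].
- by exists Y.
Qed.

Lemma unital_subbimod X (hX : subRR X) :
  mul_set R X = X -> mul_set X R = X -> unital (subbimod hX).
Proof.
have aX := subbimod_addsub hX.
move=> RX XR; split=> x.
- have : mul_set R X (sub_val x) by rewrite RX; exact: sub_valP.
  move=> /(mul_set_sum (subring_addsub R) (subbimod_addsub hX))[s xs]; exists s.
  apply: sub_val_inj; rewrite xs.
  by rewrite (add_map_sum (f := sub_val) (@sub_valD _ _ _)).
- have : mul_set X R (sub_val x) by rewrite XR; exact: sub_valP.
  move=> /(mul_set_sum (subbimod_addsub hX) (subring_addsub R))[s xs]; exists s.
  apply: sub_val_inj; rewrite xs.
  by rewrite (add_map_sum (f := sub_val) (@sub_valD _ _ _)).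
Qed.

Definition sub_pairing X Y (hX : subRR X) (hY : subRR Y)
    (XY : mul_set X Y `<=` R) (x : subbimod hX) (y : subbimod hY) : R :=
  sub_of (subring_addsub R) (XY _ (mul_setM (sub_valP x) (sub_valP y))).

Lemma sub_pairingP X Y (hX : subRR X) (hY : subRR Y) (XY : mul_set X Y `<=` R) :
  R `<=` mul_set X Y -> is_pairing (@sub_pairing X Y hX hY XY).
Proof.
move=> RXY; split=> [|r x y|x y r|r].
- split=> *; apply: incl_inj; rewrite ?inclD.
  + exact: rmulDl.
  + exact: rmulDr.
  + exact/esym/rmulA.
- by apply: incl_inj; exact/esym/rmulA.
- by apply: incl_inj; exact/rmulA.
- have [s rs] := mul_set_sum (subbimod_addsub hX) (subbimod_addsub hY)
    (RXY _ (sub_valP r)).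
  by exists s; apply: incl_inj; rewrite incl_sum [LHS]rs.
Qed.

(** For mutually inverse sub-bimodules the multiplication of [S] gives both
    contexts, so the inclusions form a morphism of contexts. *)
Lemma Inv_linked X (hX : subRR X) : gset (Inv R) X ->
  linked (Triple (@subbimod_val _ _ _ _ hX : _ -> regular S)).
Proof.
move=> IX; have [Y [hY RY YR _] [XY YX]] := Inv_inverse IX.
case: IX => _ RX XR _.
have [XYs YXs] : mul_set X Y `<=` R /\ mul_set Y X `<=` R by rewrite XY YX; split.
have xy : is_pairing (@sub_pairing X Y hX hY XYs) by apply: sub_pairingP; rewrite XY.
have yx : is_pairing (@sub_pairing Y X hY hX YXs) by apply: sub_pairingP; rewrite YX.
have xyx (p : subbimod hX) (q : subbimod hY) p' :
    sub_pairing XYs p q *< p' = p >* sub_pairing YXs q p'.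
  by apply: sub_val_inj; exact/esym/rmulA.
have yxy (q : subbimod hY) (p : subbimod hX) q' :
    sub_pairing YXs q p *< q' = q >* sub_pairing XYs p q'.
  by apply: sub_val_inj; exact/esym/rmulA.
exists (subbimod hY), (regular S), (Context xy yx xyx yxy), (ctx_regular hS).
exists (@subbimod_val _ _ _ _ hY).
split; try exact: unital_subbimod; try exact: unital_regular.
by [].
Qed.

Lemma map_D'E X (hX : subRR X) :
  map_D' (R := R) X = triple_class (Triple (@subbimod_val _ _ _ _ hX : _ -> regular S)).
Proof.
apply/funext => Z; apply/propext; split=> [[h]|]; last by exists hX.
by rewrite (Prop_irrelevance h hX).
Qed.

Section Range.
Variables (P : bimod R R) (f : P -> S).
Hypothesis fh : is_bihom (f : P -> S_RR R).

Lemma subRR_range : subRR (range f).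
Proof.
have [fD fL fR] := fh; split=> [|r _ [p _ <-]|_ r [p _ <-]].
- split=> [|_ _ [p _ <-] [q _ <-]]; first by exists 0 => //; exact: add_map0.
  by exists (p - q) => //; exact: add_mapB.
- by exists (r *< p).
- by exists (p >* r).
Qed.

Lemma range_unital : unital P ->
  mul_set R (range f) = range f /\ mul_set (range f) R = range f.
Proof.
move=> [uP uP']; have [_ fL fR] := fh; have [aF lF rF] := (subRRP _).1 subRR_range.
have FD := addsubD aF; split; apply/seteqP; split=> [|_ [p _ <-]].
- by apply: mul_set_sub => //; case: aF.
- have [e <-] := lunital_fix hR uP p; rewrite fL.
  by apply: mul_setM; [exact: sub_valP|exists p].
- by apply: mul_set_sub => //; [case: aF|move=> x r Xx Rr; exact: rF].
- have [e <-] := runital_fix hR uP' p; rewrite fR.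
  by apply: mul_setM; [exists p|exact: sub_valP].
Qed.

Lemma range_mul (Q : bimod R R) (h : Q -> S) (k : P -> Q -> R) :
  is_pairing k -> (forall p q, incl (k p q) = f p ** h q) ->
  mul_set (range f) (range h) = R.
Proof.
move=> [_ _ _ kS] kE; apply/seteqP; split=> [|r Rr].
  apply: mul_set_sub => [|x y|_ _ [p _ <-] [q _ <-]].
  - by case: (subring_addsub R).
  - exact: addsubD (subring_addsub R) x y.
  - by rewrite -kE; exact: sub_valP.
have [s rs] := kS (sub_of (subring_addsub R) Rr).
rewrite -[r]/(incl (sub_of (subring_addsub R) Rr)) rs incl_sum.
apply: big_ind => [||x _]; [exact: mul_set0|exact: mul_setD|rewrite kE].
by apply: mul_setM; [exists x.1|exists x.2].
Qed.

End Range.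

(** Since [X] is isomorphic to [S], the bimodule [S] can serve as its inverse,
    so [g \o phi] and its companion [psi] have values in [S] and their images are
    inverse to each other. The map [phi] is injective, hence nothing is lost in
    passing to the image. *)
Lemma linked_image (T : triple R) (g : triple_X T -> regular S) : linked T ->
  is_biiso g -> let Z := range (g \o @triple_phi S R T) : set S in
  gset (Inv R) Z /\ triple_class T = map_D' (R := R) Z.
Proof.
move=> lT gi Z.
have hT := ((invertible_tripleP hRS T).2 lT); case: (hT) => tT _ _.
have [Q [_ [c [_ [_ [uP uX uQ _ _]]]]]] := lT.
have [d [d1 d2]] := ctx_transport (ctx_regular hS) gi.
have [psi [[hD hL hR'] [psiD psiL psiR] e1 e2]] :=
  triple_ctx_mor hRS c d tT uQ (unital_regular hS).
have [[gD gL gR] gb] := gi.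
have f_hom : is_bihom (g \o @triple_phi S R T : triple_P T -> S_RR R).
  by split=> *; rewrite /= ?hD ?hL ?hR' ?gD // ?[LHS]gL ?[LHS]gR.
have psi_hom : is_bihom (psi : Q -> S_RR R) by [].
have hZ : subRR Z := subRR_range f_hom.
have [RZ ZR] := range_unital f_hom uP.
have ZY : mul_set Z (range psi) = R.
  by apply: range_mul (cpq_pairing c) _ => p q; rewrite e1 d1.
have YZ : mul_set (range psi) Z = R.
  by apply: range_mul (cqp_pairing c) _ => q p; rewrite e2 d2.
split; first by split=> //; exists (range psi); split=> //; exact: subRR_range.
rewrite (map_D'E hZ); apply/triple_classE.
pose f (p : triple_P T) : subbimod hZ :=
  sub_of (subbimod_addsub hZ) (imageT (g \o @triple_phi S R T) p).
have [fD fL fR] := f_hom.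
apply: (@triple_iso_of _ _ T
  (Triple (@subbimod_val _ _ _ _ hZ : _ -> regular S)) f g) => //.
split; first by split=> *; apply: sub_val_inj; [exact: fD|exact: fL|exact: fR].
apply: add_map_bij => [x y|x x0|y].
- by apply: sub_val_inj; exact: fD.
- have := congr1 sub_val x0; rewrite /= => gx0.
  apply: (linked_inj hRS lT); apply: (bij_inj gb).
  by rewrite [RHS](add_map0 fD).
- by have [p _ py] := sub_valP y; exists p; exact: sub_val_inj.
Qed.

End InvGroup.

(** * The kernel of the hat homomorphism *)

Section KerHat.
Variables (S : rng) (R : subring S) (E : set S) (RE : is_extension R E).
Let hRS := extension_units RE.

Definition aut_S (lam : S -> S) := is_biiso (lam : regular S -> regular S).

(** For a unit [e] of [s] put [u = lam e] and [v = inv_fun lam e]. Then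
    [v ** u = e = u ** v], so [v ** s ** u = s] says that [u] commutes with [s].
    Hence [lam s = s ** u = u ** s], which is right linear in [s]. *)
Lemma Ker_hatP lam : gset (Ker (@hat S R E)) lam <-> aut_S lam.
Proof.
have exU s t : exists2 e, Units E s e & Units E t e.
  case: RE => _ _ [_ EU]; have [e Ee eP] := EU [:: s; t].
  have [es se] := eP s (mem_head _ _); have [et te] := eP t (mem_last s [:: t]).
  by exists e.
have inclE e : E e -> exists r : R, incl r = e.
  by case: RE => ER _ _ /ER Re; exists (sub_of (subring_addsub R) Re).
have Eid e : E e -> e ** e = e by case: RE => _ _ [+ _]; exact.
split=> [[lamA lam1]|lamS].
- have [[lamD lamL lamR] [mu muK Kmu]] := lamA.
  have invE y : lam (inv_fun lam y) = y.
    by apply: (@xgetPex _ 0 (lam @^-1` [set y])); exists (mu y).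
  have lamM a x : lam (a ** x) = a ** lam x by exact: lamL.
  have comm s e : Units E s e -> lam s = lam e ** s.
    move=> Use; have [Ee es se] := Use; have [r re] := inclE e Ee.
    have lamRe x : lam (x ** e) = lam x ** e by rewrite -re; exact: lamR.
    set u := lam e; set v := inv_fun lam e.
    have ue : u ** e = u by rewrite -lamRe Eid.
    have uv : u ** v = e.
      by apply: (can_inj muK); rewrite lamM invE.
    have : v ** s ** u = s by rewrite -(hatE RE lamA Use) lam1.
    move=> /(congr1 (fun x => u ** x)); rewrite !rmulA uv es => <-.
    by rewrite -lamM se.
  split; last by exists mu.
  split=> // s t; have [e Us Ut] := exU s t.
  have [Ee es se] := Us; rewrite (comm _ e); last first.
    by case: Ut => _ _ te; split=> //; rewrite ?rmulA ?es // -rmulA te.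
  by rewrite (comm s e) // rmulA.
- have [[lamD lamL lamR] lamb] := lamS.
  have lamA : gset (Aut_SR R) lam by split=> //; split=> // x r; exact: lamR.
  split=> //; apply/funext => s; have [e Us _] := exU s s; have [Ee es se] := Us.
  rewrite (hatE RE lamA Us).
  have [mu muK Kmu] := lamb.
  have invE y : lam (inv_fun lam y) = y.
    by apply: (@xgetPex _ 0 (lam @^-1` [set y])); exists (mu y).
  rewrite -[LHS]lamL -[LHS]/(lam (inv_fun lam e ** s ** e)) -rmulA se.
  by rewrite [LHS](lamR (inv_fun lam e) s) invE.
Qed.

Lemma Ker_hat_group : is_group (Ker (@hat S R E)).
Proof.
split=> [|f g /Ker_hatP fS /Ker_hatP gS|f g h _ _ _|f _|f /Ker_hatP fS].
- exact/Ker_hatP/biiso_id.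
- exact/Ker_hatP/(biiso_comp gS fS).
- by [].
- by [].
- have [g gS [fK gK]] := biiso_inv fS; exists g; first exact/Ker_hatP.
  by split; apply/funext => x /=; rewrite ?fK ?gK.
Qed.

(** The preimage of [R] under [lam] is the image of [R] under the inverse of
    [lam], so both claims are about the triple of [R] included in [S]. *)
Lemma map_D_linked lam : aut_S lam ->
  gset (Inv R) (map_D (R := R) lam) /\
  map_D' (R := R) (map_D (R := R) lam) = gone (PSR R).
Proof.
move=> lamS; have [mu muS [lamK muK]] := biiso_inv lamS.
have [h1 h2] := linked_image hRS (linked_one hRS) muS.
suff -> : map_D (R := R) lam = range (mu \o @incl S R) by [].
apply/seteqP; split=> [x Rx|_ [r _ <-]].
  by exists (sub_of (subring_addsub R) Rx) => //=; rewrite lamK.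
by rewrite /map_D /= muK; exact: sub_valP.
Qed.

(** For [r = lam (lam' x)] and a left unit [e] of [r] in [R], the inverse of
    [lam \o lam'] takes [r = e ** r] apart: the inverse of [lam] can be applied
    to the factor [e] and that of [lam'] to the factor [r]. *)
Lemma map_D_mul lam lam' : aut_S lam -> aut_S lam' ->
  map_D (R := R) (lam \o lam') = mul_set (map_D (R := R) lam) (map_D (R := R) lam').
Proof.
move=> lamS lamS'; have [mu [[_ _ muR] _] [lamK muK]] := biiso_inv lamS.
have [mu' [[_ muL' _] _] [lamK' muK']] := biiso_inv lamS'.
have [[[lamD lamL lamR] _] [[lamD' lamL' lamR'] _]] := (lamS, lamS').
apply/seteqP; split=> [x Rx|].
  have [e eP] := hRS [:: lam (lam' x)]; have [er _] := eP _ (mem_head _ _).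
  have -> : x = mu (incl e) ** mu' (lam (lam' x)).
    rewrite -[RHS]muL' -[_ *< _](muR (incl e) (lam (lam' x))).
    by rewrite [_ >* _]er lamK lamK'.
  by apply: mul_setM; rewrite /map_D /= ?muK ?muK' //; exact: sub_valP.
apply: mul_set_sub => [|x y|w v Rw Rv]; rewrite /map_D /=.
- by rewrite (add_map0 lamD') (add_map0 lamD); case: (subring_addsub R).
- by rewrite lamD' lamD; exact: addsubD (subring_addsub R) _ _.
- rewrite [lam' _]lamL' [lam _]lamR; exact: subring_mul.
Qed.

End KerHat.

(** * The exact sequence *)

Section Homomorphisms.
Variables (S : rng) (R : subring S) (hRS : units_from R).
Let hS := units_from_S hRS.

(** The product of the triples of [X] and [Y] has [S (x) S] as its second
    component, and its image under multiplication is [X Y]. *)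
Lemma map_D'_mul (X Y : set S) : gset (Inv R) X -> gset (Inv R) Y ->
  map_D' (R := R) (mul_set X Y) =
  gmul (PSR R) (map_D' (R := R) X) (map_D' (R := R) Y).
Proof.
move=> IX IY; have [hX _ _ _] := IX; have [hY _ _ _] := IY.
have [lX lY] := (Inv_linked hRS hX IX, Inv_linked hRS hY IY).
rewrite (map_D'E hX) (map_D'E hY) PSR_mulE //.
have lXY := linked_mul hRS lX lY.
have mi := lunit_biiso hS (unital_regular hS).1; have [[mD _ _] _] := mi.
have [_ ->] := linked_image hRS lXY mi.
have [bX bY] := (linked_bihom lX, linked_bihom lY).
set F := (X in range X).
have FE x y : F (pure x y) = sub_val x ** sub_val y.
  exact: (etrans (congr1 (@lunit _ _ (regular S)) (triple_mulE bX bY x y)) (lunitE _ _)).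
have FD t u : F (t + u) = F t + F u
  by exact: (etrans (congr1 (@lunit _ _ (regular S)) (triple_mulD bX bY t u)) (mD _ _)).
congr (map_D' _); apply/seteqP; split=> [|_ [t _ <-]].
- apply: mul_set_sub => [|_ _ [t _ <-] [u _ <-]|x y Xx Yy].
  + by exists 0 => //; exact: add_map0 FD.
  + by exists (t + u).
  + pose x' : subbimod hX := sub_of (subbimod_addsub hX) Xx.
    pose y' : subbimod hY := sub_of (subbimod_addsub hY) Yy.
    by exists (pure x' y') => //; exact: (FE x' y').
- move: t; apply: tensor_ind => [x y|t u ht hu]; last by rewrite FD; exact: mul_setD.
  by rewrite FE; apply: mul_setM; exact: sub_valP.
Qed.

Lemma map_D'_hom : @is_group_hom (Inv R) (PSR R) (@map_D' S R).
Proof.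
split=> [X IX|]; last exact: map_D'_mul.
have [hX _ _ _] := IX; rewrite (map_D'E hX).
exact: PSR_class (Inv_linked hRS hX IX).
Qed.

(** An isomorphism from the triple of [X] to the triple of [R] is an
    [S]-bilinear automorphism of [S] that carries [X] onto [R]. *)
Lemma ker_map_D' (X : set S) : gset (Inv R) X ->
  map_D' (R := R) X = gone (PSR R) ->
  exists2 lam, aut_S lam & map_D (R := R) lam = X.
Proof.
move=> [hX _ _ _]; rewrite (map_D'E hX) => /triple_classE.
move=> /triple_iso_biiso[f [g [[_ [f' fK f'K]] gi fg]]]; exists g => //.
have [_ /bij_inj ginj] := gi; rewrite /= in fg.
apply/seteqP; split=> [x Rx|x Xx].
- pose r : R := sub_of (subring_addsub R) Rx.
  have -> : x = sub_val (f' r) by apply: ginj; rewrite [RHS]fg f'K.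
  exact: sub_valP.
- pose x' : subbimod hX := sub_of (subbimod_addsub hX) Xx.
  by rewrite /map_D /= (fg x' : g x = incl (f x')); exact: sub_valP.
Qed.

(** Replace a triple whose second component is isomorphic to [S] by its image in
    [S]. *)
Lemma ker_map_Or C : gset (PSR R) C -> map_Or C = gone (Pic S) ->
  exists2 X, gset (Inv R) X & map_D' (R := R) X = C.
Proof.
move=> [T /(invertible_tripleP hRS) lT ->]; rewrite map_Or_class => /biclassE[g gi].
by have [IZ TZ] := linked_image hRS lT gi; exists (range (g \o @triple_phi S R T)).
Qed.

Lemma map_Or_D' X : gset (Inv R) X -> map_Or (map_D' (R := R) X) = gone (Pic S).
Proof. by move=> [hX _ _ _]; rewrite (map_D'E hX) map_Or_class. Qed.

End Homomorphisms.

Theorem proposition4p1 (S : rng) (R : subring S) (E : set S) :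
  is_extension R E ->
  let K := Ker (@hat S R E) in
  let K0 := subgroup_data (G := Aut_SR R)
    (fun lam => gset (Ker (@map_D S R)) lam /\ gset K lam) in
  [/\ @is_exact trivial_group K0 K (trivial_hom K0) idfun,
      @is_exact K0 K (Inv R) idfun (@map_D S R),
      @is_exact K (Inv R) (PSR R) (@map_D S R) (@map_D' S R)
    & @is_exact (Inv R) (PSR R) (Pic S) (@map_D' S R) (@map_Or S R)].
Proof.
move=> RE K K0; have hRS := extension_units RE.
have hS := units_from_S hRS.
have Kgrp : is_group K := Ker_hat_group RE.
have KP lam : gset K lam <-> aut_S lam := Ker_hatP RE lam.
have K0P lam : gset K0 lam <-> gset K lam /\ map_D (R := R) lam = gone (Inv R).
  by split=> [[_ [[_ Dl] Kl]]|[Kl Dl]] //; have [Al _] := Kl.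
have D_hom : @is_group_hom K (Inv R) (@map_D S R).
  split=> [lam /KP/(map_D_linked RE)[]//|lam lam' /KP lamS /KP lamS'].
  exact: (map_D_mul RE).
have K0grp : is_group K0.
  have [K1 KM KA Ku Kinv] := Kgrp; have [DK DM] := D_hom.
  have [I1 _ _ Iu _] := Inv_group hRS.
  have D1 : map_D (R := R) idfun = gone (Inv R) by apply/seteqP; split.
  split=> [|f g /K0P[Kf Df] /K0P[Kg Dg]|f g h _ _ _|f _|f /K0P[Kf Df]] //.
  - exact/K0P.
  - apply/K0P; split; first exact: KM.
    by rewrite DM // Df Dg; exact: mul_setRR.
  - have [g Kg [fg gf]] := Kinv f Kf; exists g => //; apply/K0P; split=> //.
    have [<- _] := Iu _ (DK g Kg).
    by rewrite -[X in gmul _ X _ = _]Df -[LHS]DM // fg.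
have Tgrp : is_group trivial_group.
  by split=> // -[] //; exists tt.
have K0K : @is_group_hom K0 K idfun by split=> // lam /K0P[].
have T_hom : is_group_hom (trivial_hom K0).
  have [K01 _ _ K0u _] := K0grp.
  by split=> // x y _ _; rewrite /trivial_hom; have [-> _] := K0u _ K01.
split; split.
- by [].
- move=> y; split=> [[x _ <-]|[_ /= ->]]; last by exists tt.
  by split=> //; case: K0grp.
- by split=> //; exact: Inv_group.
- move=> y; split=> [[x /K0P[Kx Dx] <-]|[Ky Dy]] //; exists y => //; exact/K0P.
- by split=> //; [exact: Inv_group|exact: PSR_group|exact: map_D'_hom].
- move=> X; split=> [[lam /KP lamS <-]|[IX DX]].
    by have [] := map_D_linked RE lamS.
  by have [lam /KP lamS lamX] := ker_map_D' IX DX; exists lam.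
- split; [exact: Inv_group|exact: PSR_group|exact: Pic_group| |].
  + exact: map_D'_hom.
  + exact: map_Or_hom.
- move=> C; split=> [[X IX <-]|[PC OC]]; last exact: ker_map_Or.
  by split; [exact: (map_D'_hom hRS).1|exact: map_Or_D'].
Qed.
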